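(* Let $(M,L)$ be a Finsler manifold which admits a concurrent $\pi$-vector field $\overline{\zeta}$, and let $\lambda_{o}$ be a $\pi$-form of order one with $\lambda_{o}(\overline{\zeta})\neq 0$. Then the following assertions are equivalent: (a) $(M,L)$ is a $C^h$-recurrent manifold (with recurrence form $\lambda_o$), i.e. $\nabla_{\beta\overline{X}}T=\lambda_{o}(\overline{X})\,T$ for all $\overline{X}$; (b) $(M,L)$ is a $C^v$-recurrent manifold (with recurrence form $\lambda_o$), i.e. $(\nabla_{\gamma\overline{X}}T)(\overline{Y},\overline{Z})=\lambda_{o}(\overline{X})\,T(\overline{Y},\overline{Z})$ for all $\overline{X},\overline{Y},\overline{Z}$; (c) $(M,L)$ is a $C^0$-recurrent manifold (with recurrence form $\lambda_o$), i.e. $(D^{\circ}_{\gamma\overline{X}}T)(\overline{Y},\overline{Z})=\lambda_{o}(\overline{X})\,T(\overline{Y},\overline{Z})$ for all $\overline{X},\overline{Y},\overline{Z}$; (d) $(M,L)$ is a Riemannian manifold.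
   Context: $M$ is a real paracompact smooth manifold of finite dimension $n$; all objects are $C^\infty$. $\pi:\mathcal{T}M\to M$ is the bundle of nonzero tangent vectors, $\pi^{-1}(TM)\to\mathcal{T}M$ the pullback of $TM$ by $\pi$. Sections of $\pi^{-1}(TM)$ are called $\pi$-vector fields, are written with bars, and form the module $\mathfrak{X}(\pi(M))$; a $\pi$-form of order one is a section of the dual bundle. The fundamental $\pi$-vector field is $\overline{\eta}(u)=(u,u)$. $\rho:T(\mathcal{T}M)\to\pi^{-1}(TM)$ is $\rho=(\pi_{\mathcal{T}M},d\pi)$, and $\gamma:\pi^{-1}(TM)\to T(\mathcal{T}M)$ is the vertical lift $\gamma(u,v)=j_u(v)$, with $j_u:T_{\pi(u)}M\to T_u(T_{\pi(u)}M)$ the natural isomorphism. $(M,L)$ is a Finsler manifold with Finsler metric $g$ on $\pi^{-1}(TM)$ (locally $g_{ij}=\frac12\partial^2L^2/\partial y^i\partial y^j$). For a linear connection $D$ on $\pi^{-1}(TM)$ its connection map is $K(X)=D_X\overline{\eta}$; $D$ is regular if $T_u(\mathcal{T}M)=V_u(\mathcal{T}M)\oplus\ker K_u$ for all $u$ ($V$ the vertical bundle), and then its horizontal map is $\beta:=(\rho|_{\ker K})^{-1}$. The torsion is $\mathbf{T}(X,Y)=D_X\rho Y-D_Y\rho X-\rho[X,Y]$, with $Q(\overline{X},\overline{Y})=\mathbf{T}(\beta\overline{X},\beta\overline{Y})$ and $(h)hv$-torsion $T(\overline{X},\overline{Y})=\mathbf{T}(\gamma\overline{X},\beta\overline{Y})$.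 The curvature is $\mathbf{K}(X,Y)\rho Z=-D_XD_Y\rho Z+D_YD_X\rho Z+D_{[X,Y]}\rho Z$, with $P(\overline{X},\overline{Y})\overline{Z}=\mathbf{K}(\beta\overline{X},\gamma\overline{Y})\overline{Z}$ and $\widehat{P}(\overline{X},\overline{Y})=P(\overline{X},\overline{Y})\overline{\eta}$. The Cartan connection $\nabla$ is the unique regular connection on $\pi^{-1}(TM)$ with $\nabla g=0$, $Q=0$ and $g(T(\overline{X},\overline{Y}),\overline{Z})=g(T(\overline{X},\overline{Z}),\overline{Y})$. Throughout $\beta,K,T,\widehat{P}$ are those of $\nabla$. A $\pi$-vector field $\overline{\zeta}$ is concurrent if $\nabla_{\beta\overline{X}}\overline{\zeta}=-\overline{X}$ and $\nabla_{\gamma\overline{X}}\overline{\zeta}=0$ for all $\overline{X}$. The Berwald connection is $D^{\circ}_X\overline{Y}=\nabla_X\overline{Y}+\widehat{P}(\rho X,\overline{Y})-T(KX,\overline{Y})$. $(M,L)$ is Riemannian if $g(x,y)$ is independent of $y$ (equivalently $T=0$).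
   Formalization: In dimension n = 1, ''Riemannian'' in (d) only asks that g(x,y) be independent of y on each half-line of nonzero tangent vectors, because for a positively homogeneous L that is not reversible T = 0 does not make g agree on the two half-lines. *)

(* Defs.v *)
From HB Require Import structures.
From mathcomp Require Import all_boot all_order all_algebra.
From mathcomp Require Import all_classical all_reals all_analysis.

Set Implicit Arguments.
Unset Strict Implicit.
Unset Printing Implicit Defensive.

Import Order.TTheory GRing.Theory Num.Theory.
Import numFieldNormedType.Exports.

Local Open Scope classical_set_scope.
Local Open Scope ring_scope.

Section Smooth.
Context {R : realType} {V W : normedModType R}.

(** [Ck k U f], for [U] open: [f] is k times differentiable on [U] and the
    iterated directional derivatives of order at most k are continuous there. *)
Fixpoint Ck (k : nat) (U : set V) (f : V -> W) : Prop :=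
  match k with
  | 0%N => forall x, U x -> {for x, continuous f}
  | k'.+1 => (forall x, U x -> differentiable f x)
             /\ forall v : V, Ck k' U ('D_v f)
  end.

Definition smooth (U : set V) (f : V -> W) : Prop := forall k, Ck k U f.

End Smooth.

Definition paracompact (T : topologicalType) : Prop :=
  forall U : set (set T),
    (forall A, U A -> open A) -> \bigcup_(A in U) A = setT ->
  exists W : set (set T),
    [/\ forall B, W B -> open B,
        \bigcup_(B in W) B = setT,
        forall B, W B -> exists2 A, U A & B `<=` A &
        forall x : T, exists2 N, nbhs x N &
          finite_set [set B | W B /\ B `&` N !=set0]].

(** Charts of [M]; only the values of [cmap] on [cdom] and of [cinv] on the
    image of [cmap] are meaningful. *)
Record chart (R : realType) (n : nat) (M : topologicalType) := Chart {
  cdom : set M;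
  cmap : M -> 'rV[R]_n;
  cinv : 'rV[R]_n -> M;
  cdom_open : open cdom;
  cran_open : open (cmap @` cdom);
  cmapK : forall p, cdom p -> cinv (cmap p) = p;
  cmap_continuous : {within cdom, continuous cmap};
  cinv_continuous : {within cmap @` cdom, continuous cinv}
}.

Definition trans (R : realType) (n : nat) (M : topologicalType)
    (c d : chart R n M) : 'rV[R]_n -> 'rV[R]_n := cmap d \o cinv c.

(** Smooth manifolds.  An atlas determines the smooth structure, so it is not
    required to be maximal.  [chart_at p] is a chosen chart around [p]; it
    serves to represent tangent vectors, see below. *)
Record manifold (R : realType) (n : nat) := Manifold {
  mcarrier :> topologicalType;
  m_hausdorff : hausdorff_space mcarrier;
  m_paracompact : paracompact mcarrier;
  atlas : set (chart R n mcarrier);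
  atlas_compat : forall c d, atlas c -> atlas d ->
    smooth (cmap c @` (cdom c `&` cdom d)) (trans c d);
  chart_at : mcarrier -> chart R n mcarrier;
  chart_at_atlas : forall p, atlas (chart_at p);
  mem_chart_at : forall p, cdom (chart_at p) p
}.

Arguments atlas {R n} m.

(** The tangent space [T_p M] is identified with [R^n] by taking components in
    [chart_at p].  Hence [TM] is [M * R^n] as a set, and the components of
    [(p, v)] in an arbitrary chart [c] around [p] are obtained by applying to
    [v] the differential at [p] of the transition map from [chart_at p] to
    [c]. *)
Definition tangent (R : realType) (n : nat) (M : manifold R n) : Type :=
  (M * 'rV[R]_n)%type.

Definition nonzero_tangent (R : realType) (n : nat) (M : manifold R n) :
  pred (M * 'rV[R]_n)%type := fun u => u.2 != 0.

Definition slit (R : realType) (n : nat) (M : manifold R n) : Type :=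
  {u : M * 'rV[R]_n | nonzero_tangent u}.

Section SlitBundle.
Context {R : realType} {n : nat} {M : manifold R n}.

Definition proj (u : slit M) : M := (val u).1.

Definition vcomp (c : chart R n M) (p : M) (v : 'rV[R]_n) : 'rV[R]_n :=
  'D_v (trans (chart_at p) c) (cmap (chart_at p) p).

(** Natural charts (x, y) of [TM]; [tran c] is the range on nonzero vectors,
    and [ttrans] is (x, y) |-> (tau x, d tau_x y) with [tau := trans c d]. *)
Definition tchart (c : chart R n M) (u : tangent M) : 'rV[R]_n * 'rV[R]_n :=
  (cmap c u.1, vcomp c u.1 u.2).

Definition tchart_inv (c : chart R n M) (z : 'rV[R]_n * 'rV[R]_n) :
    M * 'rV[R]_n :=
  let p := cinv c z.1 in (p, 'D_(z.2) (trans c (chart_at p)) z.1).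

Definition tran (c : chart R n M) : set ('rV[R]_n * 'rV[R]_n) :=
  [set z | (cmap c @` cdom c) z.1 /\ z.2 != 0].

Definition ttrans (c d : chart R n M) (z : 'rV[R]_n * 'rV[R]_n) :
    'rV[R]_n * 'rV[R]_n :=
  (trans c d z.1, 'D_(z.2) (trans c d) z.1).

(** [f] read in the natural chart induced by [c]; the value [0] is only used
    outside [tran c]. *)
Definition read (W : zmodType) (c : chart R n M) (f : slit M -> W)
    (z : 'rV[R]_n * 'rV[R]_n) : W :=
  oapp f 0 (insub (tchart_inv c z)).

(** [T_u(slit M)] is identified with [R^n * R^n] by taking components in the
    natural chart induced by [chart_at (proj u)]; [tcomp c u w] are the
    components of [w] in the natural chart induced by [c]. *)
Definition tcomp (c : chart R n M) (u : slit M) (w : 'rV[R]_n * 'rV[R]_n) :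
    'rV[R]_n * 'rV[R]_n :=
  'D_w (ttrans (chart_at (proj u)) c) (tchart (chart_at (proj u)) (val u)).

(** In [pvf], the fibre over [u] of the pulled back tangent bundle is
    [T_(proj u) M], with components in [chart_at (proj u)]. *)
Definition sfun := slit M -> R.
Definition pvf := slit M -> 'rV[R]_n.
Definition vf := slit M -> 'rV[R]_n * 'rV[R]_n.

Definition smooth_fun (f : sfun) : Prop :=
  forall c, atlas M c -> smooth (tran c) (read c f).

Definition read_pvf (c : chart R n M) (Y : pvf) :
    'rV[R]_n * 'rV[R]_n -> 'rV[R]_n :=
  read c (fun u => vcomp c (proj u) (Y u)).

Definition smooth_pvf (Y : pvf) : Prop :=
  forall c, atlas M c -> smooth (tran c) (read_pvf c Y).

Definition read_vf (c : chart R n M) (X : vf) :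
    'rV[R]_n * 'rV[R]_n -> 'rV[R]_n * 'rV[R]_n :=
  read c (fun u => tcomp c u (X u)).

Definition smooth_vf (X : vf) : Prop :=
  forall c, atlas M c -> smooth (tran c) (read_vf c X).

Definition tderive (u : slit M) (w : 'rV[R]_n * 'rV[R]_n) (f : sfun) : R :=
  let c := chart_at (proj u) in 'D_w (read c f) (tchart c (val u)).

Definition bracket (X Y : vf) : vf := fun u =>
  let c := chart_at (proj u) in
  let z := tchart c (val u) in
  'D_(X u) (read_vf c Y) z - 'D_(Y u) (read_vf c X) z.

(** In natural coordinates pi is (x, y) |-> x, so d pi (a, b) = a, and the
    vertical lift of [v] is the velocity (0, v) of t |-> (x, y + t v). *)
Definition rho_at (w : 'rV[R]_n * 'rV[R]_n) : 'rV[R]_n := w.1.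
Definition gamma_at (v : 'rV[R]_n) : 'rV[R]_n * 'rV[R]_n := (0, v).
Definition vertical (w : 'rV[R]_n * 'rV[R]_n) : Prop := rho_at w = 0.

Definition rho (X : vf) : pvf := fun u => rho_at (X u).
Definition gamma (Y : pvf) : vf := fun u => gamma_at (Y u).
Definition eta : pvf := fun u => (val u).2.

Definition pi_form (l : slit M -> 'rV[R]_n -> R) : Prop :=
  (forall u, scalar (l u)) /\
  (forall Y, smooth_pvf Y -> smooth_fun (fun u => l u (Y u))).

(** [D u w Y] is the covariant derivative at [u] of the section [Y] along the
    tangent vector [w]; values on non-smooth [Y] are irrelevant. *)
Definition covder := slit M -> 'rV[R]_n * 'rV[R]_n -> pvf -> 'rV[R]_n.

Definition nabla (D : covder) (X : vf) (Y : pvf) : pvf := fun u => D u (X u) Y.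

Record linear_connection (D : covder) : Prop := LinearConnection {
  conn_linear : forall u Y, smooth_pvf Y -> linear (fun w => D u w Y);
  conn_add : forall u w Y Z, smooth_pvf Y -> smooth_pvf Z ->
    D u w (fun x => Y x + Z x) = D u w Y + D u w Z;
  conn_leibniz : forall u w f Y, smooth_fun f -> smooth_pvf Y ->
    D u w (fun x => f x *: Y x) = tderive u w f *: Y u + f u *: D u w Y;
  conn_smooth : forall X Y, smooth_vf X -> smooth_pvf Y ->
    smooth_pvf (nabla D X Y)
}.

Definition connection_map (D : covder) (u : slit M)
    (w : 'rV[R]_n * 'rV[R]_n) : 'rV[R]_n := D u w eta.

Definition regular (D : covder) : Prop := forall u : slit M,
  (forall w, exists a b,
     [/\ vertical a, connection_map D u b = 0 & w = a + b]) /\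
  (forall w, vertical w -> connection_map D u w = 0 -> w = 0).

(** The inverse of [rho] restricted to [ker K_u]. *)
Definition beta_at (D : covder) (u : slit M) (v : 'rV[R]_n) :
    'rV[R]_n * 'rV[R]_n :=
  xget 0 [set w | connection_map D u w = 0 /\ rho_at w = v].

Definition beta (D : covder) (X : pvf) : vf := fun u => beta_at D u (X u).

Definition torsion (D : covder) (X Y : vf) : pvf := fun u =>
  nabla D X (rho Y) u - nabla D Y (rho X) u - rho (bracket X Y) u.

Definition torsionQ (D : covder) (X Y : pvf) : pvf :=
  torsion D (beta D X) (beta D Y).

Definition torsionT (D : covder) (X Y : pvf) : pvf :=
  torsion D (gamma X) (beta D Y).

Definition curvature (D : covder) (X Y : vf) (Z : pvf) : pvf := fun u =>
  - nabla D X (nabla D Y Z) u + nabla D Y (nabla D X Z) u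
  + nabla D (bracket X Y) Z u.

Definition curvatureP (D : covder) (X Y Z : pvf) : pvf :=
  curvature D (beta D X) (gamma Y) Z.

Definition Phat (D : covder) (X Y : pvf) : pvf := curvatureP D X Y eta.

(** Covariant derivative along [X] of a (1,2) pi-tensor field [A], for an
    operator [D] differentiating sections along vector fields. *)
Definition nabla12 (D : vf -> pvf -> pvf) (X : vf) (A : pvf -> pvf -> pvf)
    (Y Z : pvf) : pvf := fun u =>
  D X (A Y Z) u - A (D X Y) Z u - A Y (D X Z) u.

(** The Hessian of [L^2 / 2] along the fibre: g_u (v, w) = g_ij(x, y) v^i w^j
    with g_ij = (1/2) d^2 (L^2) / dy^i dy^j. *)
Definition fmetric (L : tangent M -> R) (u : slit M) (v w : 'rV[R]_n) : R :=
  2^-1 * 'D_v (fun y : 'rV[R]_n =>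
                 'D_w (fun y' : 'rV[R]_n => L (proj u, y') ^+ 2) y) (val u).2.

Record finsler (L : tangent M -> R) : Prop := Finsler {
  finsler_ge0 : forall u, 0 <= L u;
  finsler_smooth : smooth_fun (fun u => L (val u));
  finsler_homogeneous : forall p v (t : R), 0 < t ->
    L (p, t *: v) = t * L (p, v);
  finsler_posdef : forall u v, v != 0 -> 0 < fmetric L u v v
}.

Record cartan_connection (L : tangent M -> R) (D : covder) : Prop :=
    CartanConnection {
  cartan_linear : linear_connection D;
  cartan_regular : regular D;
  cartan_metric : forall X Y Z,
    smooth_vf X -> smooth_pvf Y -> smooth_pvf Z -> forall u,
    tderive u (X u) (fun x => fmetric L x (Y x) (Z x)) =
    fmetric L u (nabla D X Y u) (Z u) + fmetric L u (Y u) (nabla D X Z u);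
  cartan_Q : forall X Y, smooth_pvf X -> smooth_pvf Y ->
    forall u, torsionQ D X Y u = 0;
  cartan_T : forall X Y Z, smooth_pvf X -> smooth_pvf Y -> smooth_pvf Z ->
    forall u, fmetric L u (torsionT D X Y u) (Z u) =
              fmetric L u (torsionT D X Z u) (Y u)
}.

Definition berwald (D : covder) (X : vf) (Y : pvf) : pvf := fun u =>
  nabla D X Y u + Phat D (rho X) Y u
  - torsionT D (fun x => connection_map D x (X x)) Y u.

Definition concurrent (D : covder) (z : pvf) : Prop :=
  smooth_pvf z /\
  forall X, smooth_pvf X -> forall u,
    nabla D (beta D X) z u = - X u /\ nabla D (gamma X) z u = 0.

Definition Ch_recurrent (D : covder) (l : slit M -> 'rV[R]_n -> R) : Prop :=
  forall X Y Z, smooth_pvf X -> smooth_pvf Y -> smooth_pvf Z -> forall u,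
    nabla12 (nabla D) (beta D X) (torsionT D) Y Z u =
    l u (X u) *: torsionT D Y Z u.

Definition Cv_recurrent (D : covder) (l : slit M -> 'rV[R]_n -> R) : Prop :=
  forall X Y Z, smooth_pvf X -> smooth_pvf Y -> smooth_pvf Z -> forall u,
    nabla12 (nabla D) (gamma X) (torsionT D) Y Z u =
    l u (X u) *: torsionT D Y Z u.

Definition C0_recurrent (D : covder) (l : slit M -> 'rV[R]_n -> R) : Prop :=
  forall X Y Z, smooth_pvf X -> smooth_pvf Y -> smooth_pvf Z -> forall u,
    nabla12 (berwald D) (gamma X) (torsionT D) Y Z u =
    l u (X u) *: torsionT D Y Z u.

(** [g] does not depend on the direction.  The guard is void unless n = 1; in
    that case the nonzero vectors of a tangent line form two half-lines, which
    a positively homogeneous [L] does not relate, and independence is required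
    on each of them. *)
Definition riemannian (L : tangent M -> R) : Prop :=
  forall u u' : slit M, proj u = proj u' ->
    (n = 1%N -> exists2 t : R, 0 < t & (val u').2 = t *: (val u).2) ->
    forall v w, fmetric L u v w = fmetric L u' v w.

End SlitBundle.

Arguments sfun {R n} M.
Arguments pvf {R n} M.
Arguments vf {R n} M.
Arguments covder {R n} M.

(* Main.v *)
From HB Require Import structures.
From mathcomp Require Import all_boot all_order all_algebra.
From mathcomp Require Import all_classical all_reals all_analysis.
From mathcomp Require Import ring lra.
Require Import Defs.

Set Implicit Arguments.
Unset Strict Implicit.
Unset Printing Implicit Defensive.

Import Order.TTheory GRing.Theory Num.Theory.
Import numFieldNormedType.Exports.

Local Open Scope classical_set_scope.
Local Open Scope ring_scope.

(** Along the fibres of the slit bundle, the Cartan connection differs from plain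
    differentiation by a tensor C.  The first component of the bracket of
    [gamma Y] and [beta Z] is the fibre derivative of [Z], so the torsion
    [T(Y, Z)] is [C(Y, Z)] ([torsionT_tensor]).  Metric compatibility and the
    symmetry axiom of T give [g(C(v, w), z) = 1/4 d_v d_w d_z L^2]
    ([cartan_tensorE]), which is symmetric in all three arguments.  Hence T
    vanishes if and only if [g] is constant along the fibres, as far as these
    are connected, which is assertion (d) ([free_riemannian],
    [riemannian_free]); and T = 0 obviously implies (a), (b) and (c).  It
    remains to derive T = 0 from each of these.

    The key is [C(v, zeta) = 0] ([tensor_zeta]).  Since the covariant derivative
    of [zeta] is [- rho], the function [phi = g(zeta, zeta)] has the differential
    [-2 g(rho, zeta)].  So [phi] is locally constant on the fibres, that is, a
    function of the base point; hence its differential, and with it the form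
    [g(., zeta)], does not depend on the fibre coordinate either.  The fibre
    derivative of [g(e, zeta)] is [g(C(v, e), zeta)], which is therefore 0, and
    the symmetry of C concludes.  It follows that the fibre derivative of [zeta]
    is 0 too, so that [zeta] is a function of the base point ([zeta_near]).

    Assume (a).  Differentiating [T(Y, zeta) = 0] along [beta X] gives
    [(nabla_{beta X} T)(Y, zeta) = T(Y, X)], which (a) says is a multiple of
    [T(Y, zeta) = 0] ([Ch_free]).  Assume (b), and take [X = zeta].  Up to terms
    with [C(zeta, .)], the left-hand side is a fourth fibre derivative of [L^2]
    with one direction equal to [zeta]; exchanging derivatives, it is a
    derivative of [C(zeta, .) = 0] ([conn_zeta_torsion]).  So
    [lambda_o(zeta) T = 0] ([zeta_recurrent_free]).  Finally the Berwald and
    Cartan connections agree along [gamma zeta], so (c) reduces to the same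
    computation ([C0_free]).

    The hypotheses speak of globally defined smooth fields only.  Pointwise
    conclusions thus require global fields with prescribed values, which are
    built with bump functions ([exists_frame]); and since the torsion contains a
    bracket with [beta Z], the horizontal map must be shown to preserve
    smoothness ([smooth_beta]). *)

(** * Functions of class C^k *)

Section CkBasic.
Context {R : realType}.
Implicit Types (V W Z : normedModType R).

(** [differentiable] speaks of the chosen differential ['d f x], so it is
    transferred along local equality through uniqueness of the differential. *)
Lemma near_eq_differentiable V W (f g : V -> W) (x : V) :
  {near x, f =1 g} -> differentiable f x -> differentiable g x.
Proof.
move=> fg df.
have E : g \o shift x = cst (g x) + 'd f x +o_ 0 id.
  have := diff_locally df => /eqaddoP H.
  apply/eqaddoP => e e0; have := H e e0; apply: filter_app.
  have : \forall h \near (0 : V), f (h + x) = g (h + x).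
    by have := fg; rewrite [X in X -> _](near_shift 0) subr0.
  apply: filterS => h /= fgh.
  by rewrite !fctE /= fgh (nbhs_singleton fg).
have dE : 'd g x = 'd f x :> (V -> W).
  by apply: diff_unique E; exact: diff_continuous.
apply/diff_locallyP; split; first by rewrite dE; exact: diff_continuous.
by rewrite dE.
Qed.

Lemma open_eq_near V W (U : set V) (f g : V -> W) x :
  open U -> U x -> (forall y, U y -> f y = g y) -> {near x, f =1 g}.
Proof.
move=> oU Ux fg; have : nbhs x U by exact: open_nbhs_nbhs.
exact: filterS.
Qed.

Lemma Ck_eq V W k (U : set V) (f g : V -> W) :
  open U -> (forall y, U y -> f y = g y) -> Ck k U f -> Ck k U g.
Proof.
move=> oU; elim: k f g => [|k IH] f g fg /=.
  move=> cf x Ux; have fgx := open_eq_near oU Ux fg.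
  rewrite /prop_for /continuous_at -(nbhs_singleton fgx).
  by apply: cvg_trans (cf x Ux); apply: near_eq_cvg; apply: filterS fgx => y ->.
move=> [df Hf]; split=> [x Ux|v].
  exact: near_eq_differentiable (open_eq_near oU Ux fg) (df x Ux).
apply: IH (Hf v) => y Uy; apply: near_eq_derive.
exact: open_eq_near oU Uy fg.
Qed.

Lemma Ck_sub V W k (U U' : set V) (f : V -> W) :
  U' `<=` U -> Ck k U f -> Ck k U' f.
Proof.
move=> sU; elim: k f => [|k IH] f /=; first by move=> cf x /sU; exact: cf.
by move=> [df Hf]; split=> [x /sU|v]; [exact: df|exact: IH].
Qed.

(** This glues local formulas: a field has an explicit smooth expression near
    each point, but not the same one everywhere. *)
Lemma Ck_local V W k (U : set V) (f : V -> W) :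
  (forall x, U x -> exists2 U', U' x & Ck k U' f) -> Ck k U f.
Proof.
elim: k f => [|k IH] f /= H.
  by move=> x Ux; have [U' U'x] := H x Ux; apply.
split=> [x Ux|v]; first by have [U' U'x []] := H x Ux; move=> d _; exact: d.
by apply: IH => x Ux; have [U' U'x []] := H x Ux; move=> _ d; exists U'.
Qed.

Lemma Ck_pred V W k (U : set V) (f : V -> W) : Ck k.+1 U f -> Ck k U f.
Proof.
elim: k f => [|k IH] f.
  by move=> [df _] x Ux; apply: differentiable_continuous; exact: df.
by move=> [df Hf]; split=> // v; apply: IH; exact: Hf.
Qed.

Lemma Ck_differentiable V W (U : set V) (f : V -> W) x :
  Ck 1 U f -> U x -> differentiable f x.
Proof. by move=> [df _]; exact: df. Qed.

Lemma Ck_cst V W k (U : set V) (w : W) : Ck k U (fun _ : V => w).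
Proof.
elim: k w => [|k IH] w /=; first by move=> x _; exact: cst_continuous.
split=> [x _|v]; first exact: differentiable_cst.
by have -> : 'D_v (fun=> w) = (fun _ : V => 0 : W) by apply/funext => x; rewrite derive_cst.
Qed.

Lemma Ck_add V W k (U : set V) (f g : V -> W) : open U ->
  Ck k U f -> Ck k U g -> Ck k U (fun x => f x + g x).
Proof.
move=> oU; elim: k f g => [|k IH] f g /=.
  by move=> cf cg x Ux; apply: cvgD; [exact: cf|exact: cg].
move=> [df Hf] [dg Hg]; split=> [x Ux|v].
  by apply: differentiableD; [exact: df|exact: dg].
apply: (@Ck_eq _ _ _ _ (fun x => 'D_v f x + 'D_v g x)) => //; last exact: IH.
by move=> x Ux; rewrite deriveD //; apply: diff_derivable; [exact: df|exact: dg].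
Qed.

Lemma Ck_sum V W k (U : set V) (I : Type) (r : seq I) (P : pred I) (f : I -> V -> W) :
  open U -> (forall i, P i -> Ck k U (f i)) ->
  Ck k U (fun x => \sum_(i <- r | P i) f i x).
Proof.
move=> oU Hf; elim: r => [|i r IH].
  apply: Ck_eq (Ck_cst k U (0 : W)) => // x _; by rewrite big_nil.
have [Pi|Pi] := boolP (P i).
  apply: Ck_eq (Ck_add oU (Hf i Pi) IH) => // x _.
  by rewrite big_cons Pi.
by apply: Ck_eq IH => // x _; rewrite big_cons (negbTE Pi).
Qed.

Lemma derive_lin_comp V W Z (l : {linear W -> Z}) (f : V -> W) v x :
  continuous l -> differentiable f x -> 'D_v (l \o f) x = l ('D_v f x).
Proof.
move=> cl df; have dl : differentiable l (f x) by exact: linear_differentiable.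
rewrite !deriveE //; last exact: differentiable_comp.
by rewrite diff_comp //= diff_lin.
Qed.

Lemma Ck_lin_comp V W Z k (U : set V) (l : {linear W -> Z}) (f : V -> W) :
  open U -> continuous l -> Ck k U f -> Ck k U (l \o f).
Proof.
move=> oU cl; elim: k f => [|k IH] f /=.
  by move=> cf x Ux; apply: continuous_comp; [exact: cf|exact: cl].
move=> [df Hf]; split=> [x Ux|v].
  by apply: differentiable_comp; [exact: df|exact: linear_differentiable].
apply: Ck_eq (IH _ (Hf v)) => // x Ux.
by rewrite /= derive_lin_comp //; exact: df.
Qed.

(** A named copy of scaling, to which a bilinear structure can be attached. *)
Definition scalev W (a : R^o) (w : W) : W := a *: w.

Lemma scale_is_bilinear W :
  bilinear_for
    (GRing.Scale.Law.clone _ _ *:%R _) (GRing.Scale.Law.clone _ _ *:%R _)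
    (@scalev W).
Proof.
rewrite /scalev; split=> [w|a] x y z /=; first by rewrite scalerDl scalerA.
by rewrite scalerDr !scalerA mulrC.
Qed.

HB.instance Definition _ W := bilinear_isBilinear.Build R R^o W W _ _
  (@scalev W) (@scale_is_bilinear W).

Lemma differentiable_scale V W (f : V -> R^o) (g : V -> W) x :
  differentiable f x -> differentiable g x ->
  differentiable (fun y => f y *: g y) x.
Proof.
move=> df dg.
have cs : continuous (fun p : R^o * W => p.1 *: p.2) by exact: scale_continuous.
pose s := @scalev W.
apply: (@differentiable_comp _ _ _ _ (fun y => (f y, g y)) (fun p => s p.1 p.2)).
  exact: differentiable_pair.
exact: differentiable_bilin.
Qed.

Lemma derive_scale V W (f : V -> R^o) (g : V -> W) v x :
  differentiable f x -> differentiable g x ->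
  'D_v (fun y => f y *: g y) x = 'D_v f x *: g x + f x *: 'D_v g x.
Proof.
move=> df dg.
have cs : continuous (fun p : R^o * W => p.1 *: p.2) by exact: scale_continuous.
pose s := @scalev W.
rewrite deriveE; last exact: differentiable_scale.
have -> : (fun y => f y *: g y) = (fun p => s p.1 p.2) \o (fun y => (f y, g y)) by [].
rewrite diff_comp; last 2 first.
- exact: differentiable_pair.
- exact: differentiable_bilin.
by rewrite /= diff_bilin // diff_pair //= /s addrC !deriveE.
Qed.

Lemma Ck_scale V W k (U : set V) (f : V -> R^o) (g : V -> W) : open U ->
  Ck k U f -> Ck k U g -> Ck k U (fun x => f x *: g x).
Proof.
move=> oU; elim: k f g => [|k IH] f g.
  by move=> cf cg x Ux; apply: cvgZ; [exact: cf|exact: cg].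
move=> Cf Cg; have [df Hf] := Cf; have [dg Hg] := Cg.
split=> [x Ux|v]; first by apply: differentiable_scale; [exact: df|exact: dg].
apply: (@Ck_eq _ _ _ _ (fun x => 'D_v f x *: g x + f x *: 'D_v g x)) => //.
  by move=> x Ux; rewrite derive_scale //; [exact: df|exact: dg].
by apply: Ck_add => //; apply: IH => //; try exact: Ck_pred; [exact: Hf|exact: Hg].
Qed.

Lemma Ck_inv V k (U : set V) (f : V -> R^o) : open U ->
  (forall x, U x -> f x != 0) ->
  Ck k U f -> Ck k U (fun x => (f x)^-1 : R^o).
Proof.
move=> oU f0; elim: k => [|k IH].
  by move=> cf x Ux; apply: (cvgV (f0 _ Ux)); exact: cf.
move=> Cf; have [df Hf] := Cf; split=> [x Ux|v].
  by apply: differentiableV; [exact: df|exact: f0].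
have CV := IH (Ck_pred Cf).
pose g x : R^o := ((f x)^-1 : R^o) *: (((f x)^-1 : R^o) *: (-1 *: 'D_v f x)).
apply: (@Ck_eq _ _ _ _ g) => //; last first.
  do 3!apply: Ck_scale => //; [exact: Ck_cst|exact: Hf].
move=> x Ux; rewrite [RHS]deriveV; last 2 first.
- exact: f0.
- by apply: diff_derivable; exact: df.
by rewrite /g /GRing.scale /= expr2 invfM mulN1r !mulrN mulrA mulNr.
Qed.

(** Continuous functionals and vectors that decompose the identity of [W].  The
    chain rule needs them because [Ck] only speaks of derivatives in fixed
    directions, whereas the derivative of a composite is taken in the moving
    direction ['D_v f x]. *)
Record coords W := Coords {
  cidx : finType;
  cvec : cidx -> W;
  cfun : cidx -> {linear W -> R^o};
  cfun_continuous : forall i, continuous (cfun i);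
  coordsE : forall w, w = \sum_i cfun i w *: cvec i
}.

Arguments cvec {W} c i.
Arguments cfun {W} c i.

Lemma derive_comp V W Z (g : W -> Z) (f : V -> W) v x :
  differentiable f x -> differentiable g (f x) ->
  'D_v (g \o f) x = 'D_('D_v f x) g (f x).
Proof.
move=> df dg; rewrite deriveE; last exact: differentiable_comp.
by rewrite diff_comp //= !deriveE.
Qed.

Lemma derive_expand V W Z (b : coords W) (g : W -> Z) (f : V -> W) v x :
  differentiable f x -> differentiable g (f x) ->
  'D_v (g \o f) x = \sum_i 'D_v (cfun b i \o f) x *: 'D_(cvec b i) g (f x).
Proof.
move=> df dg; rewrite deriveE; last exact: differentiable_comp.
rewrite diff_comp //= -(deriveE v df) {1}(coordsE b ('D_v f x)) linear_sum.
apply: eq_bigr => i _; rewrite linearZ /= -deriveE //.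
by rewrite derive_lin_comp //; exact: cfun_continuous.
Qed.

(** Induction on [k]: ['D_v (g \o f)] is a sum of products of derivatives of [f]
    and of derivatives of [g] in the fixed directions [cvec b i]. *)
Lemma Ck_comp V W Z (b : coords W) k (U : set V) (U' : set W)
    (g : W -> Z) (f : V -> W) : open U -> open U' ->
  (forall x, U x -> U' (f x)) -> Ck k U f -> Ck k U' g -> Ck k U (g \o f).
Proof.
move=> oU oU' fU; elim: k f g fU => [|k IH] f g fU.
  by move=> cf cg x Ux; apply: continuous_comp; [exact: cf|apply: cg; exact: fU].
move=> Cf Cg; have [df Hf] := Cf; have [dg Hg] := Cg; split=> [x Ux|v].
  by apply: differentiable_comp; [exact: df|apply: dg; exact: fU].
apply: (@Ck_eq _ _ _ _
  (fun x => \sum_i 'D_v (cfun b i \o f) x *: 'D_(cvec b i) g (f x))) => //.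
  move=> x Ux; rewrite (derive_expand b) //; [exact: df|apply: dg; exact: fU].
apply: Ck_sum => // i _; apply: Ck_scale => //.
  have [_] : Ck k.+1 U (cfun b i \o f).
    by apply: Ck_lin_comp => //; exact: cfun_continuous.
  exact.
by apply: (IH _ ('D_(cvec b i) g)) => //; [exact: Ck_pred|exact: Hg].
Qed.

Lemma Ck_coords V W (b : coords W) k (U : set V) (f : V -> W) : open U ->
  (forall i, Ck k U (cfun b i \o f)) -> Ck k U f.
Proof.
move=> oU H; apply: (@Ck_eq _ _ _ _ (fun x => \sum_i cfun b i (f x) *: cvec b i)) => //.
  by move=> x _; rewrite -coordsE.
by apply: Ck_sum => // i _; apply: Ck_scale => //; [exact: H|exact: Ck_cst].
Qed.

Lemma diff_linear_sum V W (b : coords V) (f : V -> W) v x : differentiable f x ->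
  'D_v f x = \sum_i cfun b i v *: 'D_(cvec b i) f x.
Proof.
move=> df; rewrite deriveE // {1}(coordsE b v) linear_sum.
by apply: eq_bigr => i _; rewrite linearZ /= deriveE.
Qed.

End CkBasic.

Arguments cvec {R W} c i.
Arguments cfun {R W} c i.

(** * Products, row vectors and matrices *)

Section Coordinates.
Context {R : realType}.
Implicit Types (V W Z : normedModType R).

Lemma derive_pair V W Z (f : V -> W) (g : V -> Z) v x :
  differentiable f x -> differentiable g x ->
  'D_v (fun y => (f y, g y)) x = ('D_v f x, 'D_v g x).
Proof.
move=> df dg; rewrite deriveE; last exact: differentiable_pair.
by rewrite diff_pair // !deriveE.
Qed.

Lemma Ck_pair V W Z k (U : set V) (f : V -> W) (g : V -> Z) : open U ->
  Ck k U f -> Ck k U g -> Ck k U (fun y => (f y, g y)).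
Proof.
move=> oU; elim: k f g => [|k IH] f g /=.
  by move=> cf cg x Ux; apply: cvg_pair; [exact: cf|exact: cg].
move=> [df Hf] [dg Hg]; split=> [x Ux|v].
  by apply: differentiable_pair; [exact: df|exact: dg].
apply: Ck_eq (IH _ _ (Hf v) (Hg v)) => // x Ux.
by rewrite derive_pair //; [exact: df|exact: dg].
Qed.

Lemma fst_continuous V W : continuous (fst : V * W -> V).
Proof. by move=> x; exact: cvg_fst. Qed.

Lemma snd_continuous V W : continuous (snd : V * W -> W).
Proof. by move=> x; exact: cvg_snd. Qed.

Lemma open_neq0 V : open [set y : V | y != 0].
Proof.
have -> : [set y : V | y != 0] = ~` [set 0] by apply/seteqP; split=> y /= /eqP.
apply: closed_openC; apply: accessible_closed_set1.
by apply: hausdorff_accessible; exact: norm_hausdorff.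
Qed.

Lemma open_fst V W (A : set V) : open A -> open [set z : V * W | A z.1].
Proof. by move/continuousP: (@fst_continuous V W) => /(_ A). Qed.

Lemma open_snd V W (A : set W) : open A -> open [set z : V * W | A z.2].
Proof. by move/continuousP: (@snd_continuous V W) => /(_ A). Qed.

Lemma derive_fst_comp V W Z (f : V -> W * Z) v x : differentiable f x ->
  'D_v (fun y => (f y).1) x = ('D_v f x).1.
Proof. by move=> df; apply: (derive_lin_comp (l := fst)) df; exact: fst_continuous. Qed.

Lemma derive_fst V W Z (F : V * W -> Z) x y v :
  'D_(v, 0) F (x, y) = 'D_v (fun x' => F (x', y)) x.
Proof.
rewrite /derive; f_equal; f_equal; apply/funext => h /=.
by congr (_ *: (F _ - _)); congr (_, _); rewrite /= scaler0 add0r.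
Qed.

Lemma derive_snd V W Z (F : V * W -> Z) x y v :
  'D_(0, v) F (x, y) = 'D_v (fun y' => F (x, y')) y.
Proof.
rewrite /derive; f_equal; f_equal; apply/funext => h /=.
by congr (_ *: (F _ - _)); congr (_, _); rewrite /= scaler0 add0r.
Qed.

Lemma derive_affine V W (f : V -> W) x e d :
  (forall h : R, f (h *: e + x) - f x = h *: d) -> 'D_e f x = d.
Proof.
move=> H; apply: lim_near_cst => //; near=> h.
rewrite /= H scalerA mulVf ?scale1r //; near: h; exact: nbhs_dnbhs_neq.
Unshelve. all: by end_near. Qed.

Lemma Ck_lin V W k (U : set V) (l : {linear V -> W}) : continuous l -> Ck k U l.
Proof.
move=> cl; case: k => [|k]; first by move=> x _; exact: cl.
split=> [x _|v]; first exact: linear_differentiable.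
have -> : 'D_v l = (fun=> l v).
  by apply/funext => x; rewrite deriveE ?diff_lin //; exact: linear_differentiable.
exact: Ck_cst.
Qed.

Lemma Ck_fst V W k (U : set (V * W)) : Ck k U fst.
Proof. by apply: Ck_lin; exact: fst_continuous. Qed.

Definition rvfun n (i : 'I_n) (w : 'rV[R]_n) : R^o := w 0 i.

Lemma rvfun_linear n i : linear (@rvfun n i).
Proof. by move=> a u v; rewrite /rvfun !mxE. Qed.

HB.instance Definition _ n i := GRing.isLinear.Build R 'rV[R]_n R^o _
  (@rvfun n i) (@rvfun_linear n i).

Lemma rvfun_continuous n i : continuous (@rvfun n i).
Proof. exact: coord_continuous. Qed.

Definition coords_rV n : coords 'rV[R]_n.
Proof.
refine (@Coords R 'rV[R]_n 'I_n (fun i => delta_mx 0 i) (fun i => rvfun i) _ _).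
  by move=> i; exact: rvfun_continuous.
by move=> w; exact: row_sum_delta.
Defined.

Definition coords_prod V W (b : coords V) (c : coords W) :
  coords (V * W : Type)%type.
Proof.
refine (@Coords R (V * W)%type (cidx b + cidx c)%type
  (fun i => match i with inl i => (cvec b i, 0) | inr i => (0, cvec c i) end)
  (fun i => match i with inl i => cfun b i \o fst | inr i => cfun c i \o snd end) _ _).
- move=> [i|i] x /=; apply: continuous_comp; try exact: cfun_continuous.
  exact: fst_continuous. exact: snd_continuous.
- move=> w; rewrite big_sumType /=.
  have -> : \sum_i cfun b i w.1 *: (cvec b i, 0 : W) = (w.1, 0).
    rewrite [LHS]surjective_pairing !linear_sum /= [in RHS](coordsE b w.1).
    by congr (_, _); rewrite big1 // => i _; rewrite scaler0.
  have -> : \sum_i cfun c i w.2 *: (0 : V, cvec c i) = (0, w.2).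
    rewrite [LHS]surjective_pairing !linear_sum /= [in RHS](coordsE c w.2).
    by congr (_, _); rewrite big1 // => i _; rewrite scaler0.
  by case: w => v w; congr (_, _); rewrite /= ?addr0 ?add0r.
Defined.

Lemma Ck_rV V n k (U : set V) (f : V -> 'rV[R]_n) : open U ->
  (forall i, Ck k U (fun x => f x 0 i : R^o)) -> Ck k U f.
Proof. by move=> oU H; apply: (@Ck_coords _ _ _ (coords_rV n)). Qed.

Lemma Ck_rV_coord V n k (U : set V) (f : V -> 'rV[R]_n) i : open U ->
  Ck k U f -> Ck k U (fun x => f x 0 i : R^o).
Proof.
by move=> oU; apply: (Ck_lin_comp (l := @rvfun n i)) => //; exact: rvfun_continuous.
Qed.

Lemma Ck_mul V k (U : set V) (f g : V -> R^o) : open U ->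
  Ck k U f -> Ck k U g -> Ck k U (fun x => f x * g x : R^o).
Proof. exact: Ck_scale. Qed.

Lemma Ck_prod V k (U : set V) (I : Type) (r : seq I) (P : pred I)
    (f : I -> V -> R^o) : open U ->
  (forall i, P i -> Ck k U (f i)) ->
  Ck k U (fun x => \prod_(i <- r | P i) f i x : R^o).
Proof.
move=> oU Hf; elim: r => [|i r IH].
  by apply: Ck_eq (Ck_cst k U (1 : R^o)) => // x _; rewrite big_nil.
have [Pi|Pi] := boolP (P i).
  by apply: Ck_eq (Ck_scale oU (Hf i Pi) IH) => // x _; rewrite big_cons Pi.
by apply: Ck_eq IH => // x _; rewrite big_cons (negbTE Pi).
Qed.

Lemma Ck_det V n k (U : set V) (A : V -> 'M[R]_n) : open U ->
  (forall i j, Ck k U (fun x => A x i j : R^o)) -> Ck k U (fun x => \det (A x) : R^o).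
Proof.
move=> oU HA; rewrite /determinant; apply: Ck_sum => // s _.
apply: (@Ck_mul V k U (fun=> (-1) ^+ perm.odd_perm s) _ oU); first exact: Ck_cst.
by apply: Ck_prod.
Qed.

(** Cramer's rule: an entry of the inverse is a cofactor over the determinant. *)
Lemma Ck_invmx V n k (U : set V) (A : V -> 'M[R]_n) : open U ->
  (forall i j, Ck k U (fun x => A x i j : R^o)) ->
  (forall x, U x -> A x \in unitmx) ->
  forall i j, Ck k U (fun x => invmx (A x) i j : R^o).
Proof.
move=> oU HA uA i j.
apply: (@Ck_eq _ _ _ _ _ (fun x => (\det (A x))^-1 * cofactor (A x) j i : R^o)) => //.
  by move=> x Ux; rewrite /invmx uA // !mxE.
apply: (Ck_mul (f := fun x => (\det (A x))^-1)) => //.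
  apply: Ck_inv => //; last exact: Ck_det.
  by move=> x Ux; rewrite -unitfE; exact: uA.
apply: (Ck_mul (f := fun=> (-1) ^+ (j + i))) => //; first exact: Ck_cst.
apply: Ck_det => // a b.
apply: (@Ck_eq _ _ _ _ _ (fun x => A x (lift j a) (lift i b) : R^o)) => //.
by move=> x _; rewrite !mxE.
Qed.
End Coordinates.

(** * Mean value theorem and symmetry of second derivatives *)

Section MeanValue.
Context {R : realType}.
Implicit Types (V W : normedModType R).

Lemma is_derive_line V W (g : V -> W) a b (t : R) :
  differentiable g (a + t *: b) ->
  is_derive t 1 (fun s : R => g (a + s *: b)) ('D_b g (a + t *: b)).
Proof.
move=> dg.
have dl : differentiable (fun s : R^o => a + s *: b) t.
  apply: differentiableD; first exact: differentiable_cst.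
  exact: ex_diff.
have dc : differentiable (g \o (fun s : R^o => a + s *: b)) t.
  exact: differentiable_comp.
split; first exact: diff_derivable.
rewrite deriveE // diff_comp //= (deriveE _ dg); congr ('d g _ _).
rewrite -(deriveE (1 : R^o) dl) deriveD; last 2 first.
- exact: derivable_cst.
- by apply: diff_derivable; exact: ex_diff.
by rewrite derive_cst add0r deriveE ?diff_val ?scale1r //; exact: ex_diff.
Qed.

Lemma mvt_line V (g : V -> R^o) a b (h : R) : 0 <= h ->
  (forall t, 0 <= t <= h -> differentiable g (a + t *: b)) ->
  exists2 t, 0 <= t <= h & g (a + h *: b) - g a = h * 'D_b g (a + t *: b).
Proof.
move=> h0 dg.
have D t : 0 <= t <= h -> is_derive t 1 (fun s : R => g (a + s *: b)) ('D_b g (a + t *: b)).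
  by move=> /dg; exact: is_derive_line.
have [||t th E] := @MVT_segment R (fun s : R => g (a + s *: b))
  (fun t => 'D_b g (a + t *: b)) 0 h h0.
- by move=> t th; apply: D; rewrite !(itvP th).
- apply: continuous_in_subspaceT => t; rewrite inE => th.
  apply: differentiable_continuous; apply/derivable1_diffP.
  by apply: ex_derive; apply: D; rewrite !(itvP th).
exists t; first by rewrite !(itvP th).
by move: E; rewrite scale0r addr0 subr0 mulrC.
Qed.

Lemma derive_translate V W (g : V -> W) c v x :
  'D_v (fun z => g (z + c)) x = 'D_v g (x + c).
Proof.
rewrite /derive; f_equal; f_equal.
by apply/funext => h /=; rewrite addrA.
Qed.

Lemma differentiable_translate V W (g : V -> W) c x :
  differentiable g (x + c) -> differentiable (fun z => g (z + c)) x.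
Proof.
by move=> dg; apply: (@differentiable_comp _ _ _ _ (fun z => z + c) g).
Qed.

(** The mean value theorem is applied along [v] to [z |-> f (z + h w) - f z], and
    then along [w] to ['D_v f]. *)
Lemma second_difference V (f : V -> R^o) v w x (h : R) : 0 <= h ->
  (forall s t, 0 <= s <= h -> 0 <= t <= h ->
     differentiable f (x + s *: v + t *: w) /\
     differentiable ('D_v f) (x + s *: v + t *: w)) ->
  exists s t, [/\ 0 <= s <= h, 0 <= t <= h &
    f (x + h *: v + h *: w) - f (x + h *: v) - (f (x + h *: w) - f x) =
      h * (h * 'D_w ('D_v f) (x + s *: v + t *: w))].
Proof.
move=> h0 H.
have h00 : 0 <= (0 : R) <= h by rewrite lexx.
have hh : 0 <= h <= h by rewrite h0 lexx.
have d1 t : 0 <= t <= h -> differentiable (fun z => f (z + h *: w)) (x + t *: v).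
  by move=> th; apply: differentiable_translate; have [] := H t h th hh.
have d2 t : 0 <= t <= h -> differentiable f (x + t *: v).
  by move=> th; have [] := H t 0 th h00; rewrite scale0r addr0.
have [|s sh E] := @mvt_line V (fun z => f (z + h *: w) - f z) x v h h0.
  by move=> t th; apply: differentiableB; [exact: d1|exact: d2].
have [|t th E'] := @mvt_line V ('D_v f) (x + s *: v) w h h0.
  by move=> t th; have [] := H s t sh th.
exists s, t; split=> //; rewrite E -E' deriveB ?derive_translate //.
- by apply: diff_derivable; exact: d1.
- by apply: diff_derivable; exact: d2.
Qed.

(** The second difference of [f] along [h v] and [h w] is symmetric in [v] and [w];
    divided by [h ^ 2], it tends to either mixed derivative by continuity. *)
Lemma schwarz V (U : set V) (f : V -> R^o) v w x : open U -> U x -> Ck 2 U f ->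
  'D_v ('D_w f) x = 'D_w ('D_v f) x.
Proof.
move=> oU Ux [df Hf].
have dd u : forall y, U y -> differentiable ('D_u f) y by have [] := Hf u.
have cc u u' : forall y, U y -> {for y, continuous ('D_u' ('D_u f))}.
  by have [_ /(_ u')] := Hf u.
apply/eqP; rewrite -subr_eq0 -normr_le0; apply/ler_addgt0Pr => e e0.
rewrite add0r.
have e2 : 0 < e / 2 by rewrite divr_gt0.
have N1 : \forall y \near x, U y /\
   (`|'D_v ('D_w f) x - 'D_v ('D_w f) y| < e / 2 /\
    `|'D_w ('D_v f) x - 'D_w ('D_v f) y| < e / 2).
  apply: filterI; first exact: open_nbhs_nbhs.
  apply: filterI.
    by have /cvgrPdist_lt := cc w v x Ux; apply.
  by have /cvgrPdist_lt := cc v w x Ux; apply.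
have [r /= r0 Hr] := (nbhs_ballP _ _).1 N1.
(* With this [h], the parallelogram on [h v] and [h w] lies in the ball of
   radius [r]. *)
pose h := r / (2 * (`|v| + `|w| + 1)).
have p0 : 0 < `|v| + `|w| + 1 by rewrite ltr_wpDl // addr_ge0.
have h0 : 0 < h by rewrite divr_gt0 // mulr_gt0.
have B s t : 0 <= s <= h -> 0 <= t <= h -> ball x r (x + s *: v + t *: w).
  move=> /andP[s0 sh] /andP[t0 th].
  rewrite -ball_normE /ball_ /= -addrA opprD addNKr normrN.
  have : `|s *: v + t *: w| <= h * (`|v| + `|w| + 1).
    apply: le_trans (ler_normD _ _) _; rewrite !normrZ !ger0_norm // !mulrDr.
    rewrite -[leLHS]addr0 lerD ?mulr1 ?(ltW h0) //.
    by rewrite lerD // ler_wpM2r.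
  move=> /le_lt_trans; apply.
  rewrite /h invfM mulrA -mulrA mulVf ?gt_eqF // mulr1.
  by rewrite ltr_pdivrMr // ltr_pMr // ltrDl.
have [s [t [sh th E]]] := @second_difference V f v w x h (ltW h0)
  (fun s t sh th => let: conj u _ := Hr _ (B s t sh th) in conj (df _ u) (dd v _ u)).
have B' s' t' : 0 <= s' <= h -> 0 <= t' <= h -> ball x r (x + s' *: w + t' *: v).
  by move=> sh' th'; rewrite addrAC; exact: B.
have [s' [t' [sh' th' E']]] := @second_difference V f w v x h (ltW h0)
  (fun s t sh th => let: conj u _ := Hr _ (B' s t sh th) in conj (df _ u) (dd w _ u)).
have EE : 'D_w ('D_v f) (x + s *: v + t *: w) = 'D_v ('D_w f) (x + s' *: w + t' *: v).
  have hn : h != 0 by rewrite gt_eqF.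
  apply: (mulfI hn); apply: (mulfI hn); apply: etrans (esym E) (etrans _ E').
  by rewrite [x + h *: w + h *: v]addrAC; move: (f _) (f _) (f _) (f _) => a b c d; ring.
have [_ [_ A1]] := Hr _ (B s t sh th).
have [_ [A2 _]] := Hr _ (B' s' t' sh' th').
rewrite EE in A1; rewrite [leRHS]splitr.
move: {EE E E'} ('D_v _ x) ('D_w _ x) ('D_v _ _) A1 A2 => a b c A1 A2.
by apply: le_trans (ler_distD c _ _) _; rewrite lerD // ltW // distrC.
Qed.

Lemma segment_constant V (f : V -> R^o) a b :
  (forall t, 0 <= t <= 1 ->
     differentiable f (a + t *: (b - a)) /\ 'D_(b - a) f (a + t *: (b - a)) = 0) ->
  f b = f a.
Proof.
move=> H; have [|t th] := @mvt_line V f a (b - a) 1 ler01; first by move=> t /H[].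
by have [_ ->] := H t th; rewrite mulr0 scale1r subrKC => /eqP; rewrite subr_eq0 => /eqP.
Qed.
End MeanValue.

(** * Bump functions *)

Section Flat.
Context {R : realType}.

(** The classical flat function is [flat 0].  The powers of [x^-1] are there to
    make the family stable under differentiation, up to linear combinations. *)
Definition flat (k : nat) (x : R^o) : R^o :=
  if 0 < x then x^-1 ^+ k * expR (- x^-1) else 0.

Lemma flat_gt0 k x : (0 < flat k x) = (0 < x).
Proof.
rewrite /flat; case: ifP => [x0|]; last by rewrite ltxx.
by rewrite mulr_gt0 ?expR_gt0 // exprn_gt0 // invr_gt0.
Qed.

Lemma flat_eq0 k x : (flat k x == 0) = (x <= 0).
Proof.
rewrite /flat; case: ltP => [x0|x0]; last by rewrite eqxx.
by rewrite mulf_eq0 expR_eq0 orbF expf_eq0 invr_eq0 gt_eqF ?andbF.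
Qed.

(** This is [t ^ k.+1 / k.+1`! <= exp t] at [t = x^-1]. *)
Lemma flat_bound k (x : R) : 0 < x -> flat k x <= (k.+1)`!%:R * x.
Proof.
move=> x0; rewrite /flat x0 expRN; set t := x^-1.
have t0 : 0 < t by rewrite invr_gt0.
have := @expR_ge1Dxn _ t k (ltW t0).
have f0 : (0 : R) < k.+1`!%:R by rewrite ltr0n fact_gt0.
have e0 := expR_gt0 t.
move=> H; rewrite ler_pdivrMr //.
have {H} : t ^+ k.+1 / k.+1`!%:R <= expR t by apply: le_trans H; rewrite lerDr.
rewrite ler_pdivrMr // => H.
have -> : t ^+ k = t ^+ k.+1 * x by rewrite exprSr -mulrA mulVf ?mulr1 ?gt_eqF.
rewrite mulrAC; apply: ler_pM => //; [by rewrite exprn_ge0 // ltW|exact: ltW|].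
by rewrite mulrC.
Qed.

Lemma is_derive_flat k (x : R) :
  is_derive x 1 (flat k) (flat k.+2 x - k%:R * flat k.+1 x).
Proof.
have [x0|x0|x0] := ltgtP x 0.
- apply: (@near_eq_is_derive _ _ _ (cst 0)).
    near=> y; rewrite /flat ltNge ltW //; near: y; exact: lt_nbhsl.
  by rewrite /flat [0 < x]ltNge ltW // mulr0 subr0; exact: is_derive_cst.
- apply: (@near_eq_is_derive _ _ _ (fun y : R => y^-1 ^+ k * expR (- y^-1))).
    near=> y; rewrite /flat ifT //; near: y; exact: lt_nbhsr.
  have xn : x != 0 by rewrite gt_eqF.
  have dV : is_derive x 1 (fun y : R => y^-1) (- x ^- 2).
    split; first by apply: (derivableV (f := id)).
    by rewrite (deriveV (f := id)) // derive_id; exact: mulr1.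
  have dX := is_deriveX k dV.
  have dE : is_derive x 1 (fun y : R => expR (- y^-1)) (expR (- x^-1) * x ^- 2).
    have dN : is_derive x 1 (fun y : R => - y^-1) (x ^- 2).
      by have := is_deriveN dV; rewrite opprK.
    exact: (@is_derive1_comp _ expR (fun y : R => - y^-1) x _ _
      (is_derive_expR (- x^-1)) dN).
  have -> : (fun y : R => y^-1 ^+ k * expR (- y^-1)) =
      (fun y : R => y^-1) ^+ k * (fun y : R => expR (- y^-1)).
    by apply/funext => y; rewrite !fctE.
  apply: is_derive_eq (is_deriveM dX dE) _.
  rewrite /flat x0 /GRing.scale /= exprfctE -exprVn.
  set t := x^-1; set e := expR _.
  by case: (k) => [|m]; rewrite ?mul0r /= ?expr0 ?exprS; ring.
- (* At 0 the difference quotient of [flat k] is [flat k.+1], which is O(x). *)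
  subst x; rewrite /flat ltxx mulr0 subr0.
  have L : (h^-1 *: ((flat k \o shift 0) (h *: 1) - flat k 0)) @[h --> 0^'] --> (0 : R).
    apply/cvgrPdist_le => e e0; near=> h.
    rewrite sub0r normrN /= addr0 {2}/flat ltxx subr0 [h%:A]mulr1.
    have [h0|h0] := leP h 0.
      by rewrite /flat ltNge h0 /= scaler0 normr0 ltW.
    have -> : h^-1 *: flat k h = flat k.+1 h.
      by rewrite /flat h0 exprS -mulrA.
    rewrite ger0_norm; last by rewrite ltW // flat_gt0.
    apply: le_trans (flat_bound _ h0) _; rewrite mulrC -ler_pdivlMr ?ltr0n ?fact_gt0 //.
    rewrite -[h]gtr0_norm //; near: h; apply: dnbhs0_le.
    by rewrite divr_gt0 // ltr0n fact_gt0.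
  split; first by apply/cvg_ex; exists 0.
  exact/cvg_lim.
Unshelve. all: by end_near. Qed.

Lemma Ck_flat K k : Ck K setT (flat k).
Proof.
elim: K k => [|K IH] k.
  move=> x _; apply: differentiable_continuous; apply/derivable1_diffP.
  by have [] := is_derive_flat k x.
split=> [x _|v].
  by apply/derivable1_diffP; by have [] := is_derive_flat k x.
apply: (@Ck_eq _ _ _ _ _ (fun x => (v : R^o) *: (flat k.+2 x + (- k%:R) *: flat k.+1 x))).
- exact: openT.
- move=> x _; have dx := is_derive_flat k x.
  rewrite deriveE; last by apply/derivable1_diffP; exact: ex_derive.
  rewrite -[v in RHS]mulr1 [X in 'd _ _ X](_ : _ = v *: (1 : R^o)) // linearZ.
  rewrite -deriveE; last by apply/derivable1_diffP; exact: ex_derive.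
  by rewrite derive_val scaleNr.
apply: (Ck_scale openT); first exact: Ck_cst.
apply: (Ck_add openT); first exact: IH.
by apply: (Ck_scale openT); [exact: Ck_cst|exact: IH].
Qed.

End Flat.

Section Box.
Context {R : realType} {n : nat}.

(** A bump supported by a cube.  A product over the coordinates is used because
    the norm of a row vector, being a maximum, is not differentiable. *)
Definition box (x0 : 'rV[R]_n) (r : R) (x : 'rV[R]_n) : R^o :=
  \prod_(i < n) flat 0 (r ^+ 2 - (x 0 i - x0 0 i) ^+ 2).

Definition coords_real : coords R^o.
Proof.
refine (@Coords R R^o unit (fun=> 1) (fun=> idfun) _ _).
  by move=> _ x; exact: cvg_id.
by move=> w; rewrite big_const card_unit /= addr0 /GRing.scale /= mulr1.
Defined.

Lemma Ck_comp_real (V : normedModType R) k (U : set V) (g : R^o -> R^o) (f : V -> R^o) :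
  open U -> Ck k U f -> Ck k setT g -> Ck k U (fun x => g (f x)).
Proof.
by move=> oU Cf Cg; apply: (@Ck_comp _ _ _ _ coords_real _ _ setT) => //; exact: openT.
Qed.

Lemma Ck_box x0 r k : Ck k setT (box x0 r).
Proof.
apply: Ck_prod => [|i _]; first exact: openT.
apply: (Ck_comp_real openT); last exact: Ck_flat.
have Cc : Ck k setT (fun x : 'rV[R]_n => x 0 i - x0 0 i : R^o).
  apply: (Ck_add openT); last exact: Ck_cst.
  exact: (Ck_lin (l := rvfun i) k setT (@rvfun_continuous R n i)).
apply: (@Ck_eq _ _ _ _ _ (fun x : 'rV[R]_n =>
  r ^+ 2 + (-1) * ((x 0 i - x0 0 i) * (x 0 i - x0 0 i)) : R^o)).
- exact: openT.
- by move=> x _; rewrite mulN1r expr2.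
apply: (Ck_add openT); first exact: Ck_cst.
by apply: (Ck_mul openT); [exact: Ck_cst|exact: (Ck_mul openT)].
Qed.

Lemma box_center_neq0 x0 r : 0 < r -> box x0 r x0 != 0.
Proof.
move=> r0; apply/prodf_neq0 => i _.
by rewrite subrr expr0n /= subr0 flat_eq0 -ltNge exprn_gt0.
Qed.

Lemma box_neq0 x0 r x : 0 <= r -> box x0 r x != 0 ->
  forall i, x0 0 i - r <= x 0 i <= x0 0 i + r.
Proof.
move=> r0 /prodf_neq0 H i; have := H i isT.
rewrite flat_eq0 -ltNge subr_gt0 -(ger0_norm r0) -real_normK ?num_real //
  -[ltRHS]real_normK ?num_real //.
rewrite ltr_pXn2r ?nnegrE ?normr_ge0 // normr_id (ger0_norm r0) ltr_norml => /andP[a b].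
by apply/andP; split; lra.
Qed.

End Box.

(** * Segments that avoid the zero vector *)

Lemma other_ord m (i : 'I_m) : m <> 1%N -> exists j, j != i.
Proof.
case: m i => [[]//|[//|m]] i _.
by have [->|i0] := eqVneq i ord0; [exists ord_max|exists ord0; rewrite eq_sym].
Qed.

(** The zero vector does not belong to the slit bundle, so functions on a fibre can
    only be followed along such segments. *)
Definition avoids0 {R : realType} {V : normedModType R} (a b : V) :=
  forall t : R, 0 <= t <= 1 -> a + t *: (b - a) != 0.

Lemma avoids0_near {R : realType} {V : normedModType R} (a : V) : a != 0 ->
  \forall b \near a, avoids0 a b.
Proof.
move=> a0; have na : 0 < `|a| by rewrite normr_gt0.
near=> b => t /andP[t0 t1].
have : `|b - a| < `|a|.
  by rewrite distrC; near: b; exact: (cvgrPdist_lt _ _).1 cvg_id _ na.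
apply: contraTneq => /eqP; rewrite addr_eq0 => /eqP E.
rewrite -leNgt {1}E normrN normrZ (ger0_norm t0).
by rewrite ler_piMl.
Unshelve. all: by end_near. Qed.

Section Paths.
Context {R : realType}.

Lemma avoids0P (V : normedModType R) (a b : V) : a != 0 ->
  (forall s, 0 <= s -> b != - s *: a) -> avoids0 a b.
Proof.
move=> a0 H t /andP[t0 t1]; apply/eqP => E.
have [tz|tn] := eqVneq t 0.
  by move: E a0; rewrite tz scale0r addr0 => ->; rewrite eqxx.
have := H ((1 - t) / t); rewrite divr_ge0 ?subr_ge0 // => /(_ isT) /eqP; apply.
have Eb : t *: b = - ((1 - t) *: a).
  apply/eqP; rewrite -addr_eq0 -E scalerBl scale1r scalerBr; apply/eqP.
  by rewrite addrC -addrA; congr (_ + _); rewrite addrC.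
apply: (scalerI tn); rewrite Eb scalerA mulrN mulrC divfK // scaleNr.
reflexivity.
Qed.

Lemma avoids0_refl (V : normedModType R) (a : V) : a != 0 -> avoids0 a a.
Proof. by move=> a0 t _; rewrite subrr scaler0 addr0. Qed.

(** If [y'] is not a nonpositive multiple of [y], the segment itself will do.
    Otherwise the dimension is at least 2, and the path turns at a basis vector
    that is not a multiple of [y]. *)
Lemma path_avoids0 m (y y' : 'rV[R]_m) : y != 0 -> y' != 0 ->
  (m = 1%N -> exists2 t : R, 0 < t & y' = t *: y) ->
  exists2 c, avoids0 y c & avoids0 c y'.
Proof.
move=> y0 y'0 guard.
have [[s s0 Es]|H] := pselect (exists2 s : R, 0 <= s & y' = - s *: y); last first.
  exists y'; last exact: avoids0_refl.
  by apply: avoids0P => // s s0; apply/eqP => Es; apply: H; exists s.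
have m1 : m <> 1%N.
  move=> /guard [t t0 Et]; move: y0; rewrite -[_ != 0]negbK; case/negP.
  have : (t + s) *: y = 0 by rewrite scalerDl -Et Es scaleNr addNr.
  move/eqP; rewrite scaler_eq0 => /orP[/eqP ts|->//].
  by have := ltr_pwDl t0 s0; rewrite ts ltxx.
have [i0 yi] : exists i, y 0 i != 0.
  apply/existsP; apply: contraNT y0; rewrite negb_exists => /forallP yz.
  by apply/eqP/rowP => i; rewrite mxE; apply/eqP; rewrite -[_ == _]negbK.
have [j ji] := other_ord i0 m1.
pose c : 'rV[R]_m := delta_mx 0 j.
have cn k : c != k *: y.
  apply/eqP => /rowP Ec; have := Ec i0; rewrite !mxE eq_sym (negbTE ji) andbF.
  move/esym/eqP; rewrite mulf_eq0 (negbTE yi) orbF => /eqP k0.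
  by have := Ec j; rewrite !mxE k0 mul0r !eqxx /= => /eqP; rewrite oner_eq0.
have c0 : c != 0 by rewrite -(scale0r y).
exists c; apply: avoids0P => // k k0; apply/eqP => Ey.
have kn : k != 0 by apply: contraNneq y'0 => kz; rewrite Ey kz oppr0 scale0r.
have := cn (s / k); case/eqP; apply: (scalerI kn).
by rewrite scalerA mulrC divfK //; apply: oppr_inj; rewrite -!scaleNr -Ey.
Qed.

Lemma near_half_line m (y : 'rV[R]_m) : y != 0 ->
  \forall y' \near y, m = 1%N -> exists2 t : R, 0 < t & y' = t *: y.
Proof.
move=> y0; apply: filterS (avoids0_near y0) => y' yy' m1; subst m.
have yn : y 0 0 != 0.
  by apply: contraNneq y0 => yz; apply/eqP/rowP => i; rewrite ord1 mxE.
pose t := y' 0 0 / y 0 0.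
have Et : y' = t *: y by apply/rowP => i; rewrite ord1 mxE divfK.
exists t => //; rewrite ltNge; apply/negP => t0.
(* For [t <= 0] the segment would meet 0 at the parameter [(1 - t)^-1]. *)
have d0 : 0 < 1 - t by lra.
have := yy' (1 - t)^-1; rewrite invr_ge0 (ltW d0) invf_le1 //= => H.
have /H /eqP : 1 <= 1 - t by lra.
have Ed : t *: y - y = (t - 1) *: y by rewrite scalerBl scale1r.
apply; rewrite Et Ed scalerA -{1}[y]scale1r -scalerDl.
have -> : 1 + (1 - t)^-1 * (t - 1) = 0 by field; rewrite gt_eqF.
exact: scale0r.
Qed.

End Paths.

(** * Linearity as a predicate *)

(** [vcomp], [tcomp] and the connection come with proofs of [linear], not as bundled
    linear maps; hence these predicate versions of the usual rules. *)
Lemma linear_at0 (K : pzRingType) (U V : lmodType K) (f : U -> V) : linear f -> f 0 = 0.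
Proof. by move=> L; have := L (-1) 0 0; rewrite scaler0 addr0 scaleN1r addNr. Qed.

Lemma linear_scale (K : pzRingType) (U V : lmodType K) (f : U -> V) k v :
  linear f -> f (k *: v) = k *: f v.
Proof. by move=> L; rewrite -[k *: v]addr0 L linear_at0 // addr0. Qed.

Lemma linear_add (K : pzRingType) (U V : lmodType K) (f : U -> V) v w :
  linear f -> f (v + w) = f v + f w.
Proof. by move=> L; rewrite -{1}[v]scale1r L scale1r. Qed.

Lemma linear_rV_sum (K : pzRingType) (W : lmodType K) m (f : 'rV[K]_m -> W) v :
  linear f -> f v = \sum_i v 0 i *: f (delta_mx 0 i).
Proof.
move=> L; pose lM := GRing.isLinear.Build _ _ _ _ _ L.
pose l : {linear 'rV[K]_m -> W} := HB.pack f lM.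
rewrite -[f]/(l : _ -> _) {1}(row_sum_delta v) linear_sum.
by apply: eq_bigr => i _; rewrite linearZ.
Qed.

(** * Transition maps of the manifold and of its tangent bundle *)

Arguments cdom_open {R n M} _.
Arguments cran_open {R n M} _.
Arguments cinv_continuous {R n M} _.

Section Charts.
Context {R : realType} {n : nat} {M : manifold R n}.
Implicit Types (a b c : chart R n M) (q : M) (v y : 'rV[R]_n)
  (w : 'rV[R]_n * 'rV[R]_n).

Lemma cinv_mem c x : (cmap c @` cdom c) x -> cdom c (cinv c x).
Proof. by move=> [q cq <-]; rewrite cmapK. Qed.

Lemma cinvK c x : (cmap c @` cdom c) x -> cmap c (cinv c x) = x.
Proof. by move=> [q cq <-]; rewrite cmapK. Qed.

Lemma image_open c (A : set M) : open A -> open (cmap c @` (cdom c `&` A)).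
Proof.
move=> oA.
have -> : cmap c @` (cdom c `&` A) = (cmap c @` cdom c) `&` (cinv c @^-1` A).
  apply/seteqP; split=> x.
    by move=> [q [cq Aq] <-]; split; [exists q|rewrite /= cmapK].
  by move=> [cx Ax]; exists (cinv c x); [split=> //; exact: cinv_mem|exact: cinvK].
rewrite openE => x [cx Ax].
have cc := cinv_continuous c.
rewrite (continuous_open_subspace _ (cran_open c)) in cc.
apply: filterI; first by apply: open_nbhs_nbhs; split=> //; exact: cran_open.
have /cc : x \in cmap c @` cdom c by rewrite inE.
by apply; apply: open_nbhs_nbhs.
Qed.

Definition overlap a b := cmap a @` (cdom a `&` cdom b).

Lemma overlap_open a b : open (overlap a b).
Proof. by apply: image_open; exact: cdom_open. Qed.

Lemma overlap_map a b q : cdom a q -> cdom b q -> overlap a b (cmap a q).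
Proof. by move=> aq bq; exists q. Qed.

Lemma trans_map a b q : cdom a q -> trans a b (cmap a q) = cmap b q.
Proof. by move=> aq; rewrite /trans /= cmapK. Qed.

Lemma smooth_trans a b k : atlas M a -> atlas M b -> Ck k (overlap a b) (trans a b).
Proof. by move=> aM bM; exact: atlas_compat. Qed.

Lemma differentiable_trans a b x : atlas M a -> atlas M b ->
  overlap a b x -> differentiable (trans a b) x.
Proof. by move=> aM bM; have [+ _] := smooth_trans 1 aM bM; exact. Qed.

(** The differential of the transition map, so that [vcomp c q] is
    [tmap (chart_at q) c q]. *)
Definition tmap a b q v : 'rV[R]_n := 'D_v (trans a b) (cmap a q).

Lemma tmap_linear a b q : atlas M a -> atlas M b -> cdom a q -> cdom b q ->
  linear (tmap a b q).
Proof.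
move=> aM bM aq bq; have d := differentiable_trans aM bM (overlap_map aq bq).
by move=> k v v'; rewrite /tmap !deriveE // linearP.
Qed.

Lemma tmap_id a q v : cdom a q -> tmap a a q v = v.
Proof.
move=> aq; rewrite /tmap (near_eq_derive _ (g := id)) ?derive_id //.
apply: open_eq_near (cran_open a) _ _; first by exists q.
by move=> x; exact: cinvK.
Qed.

Lemma tmap_comp a b c q v : atlas M a -> atlas M b -> atlas M c ->
  cdom a q -> cdom b q -> cdom c q -> tmap b c q (tmap a b q v) = tmap a c q v.
Proof.
move=> aM bM cM aq bq cq.
have dab := differentiable_trans aM bM (overlap_map aq bq).
have dbc : differentiable (trans b c) (trans a b (cmap a q)).
  by rewrite trans_map //; apply: differentiable_trans => //; exact: overlap_map.
rewrite /tmap [RHS](near_eq_derive _ (g := trans b c \o trans a b)); last first.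
  have oabc := image_open (c := a) (openI (cdom_open b) (cdom_open c)).
  apply: (open_eq_near oabc); first by exists q.
  by move=> x [p [ap [bp cp]] <-]; rewrite /= !trans_map.
by rewrite [RHS](derive_comp v dab dbc) trans_map.
Qed.

Definition overlapT a b : set ('rV[R]_n * 'rV[R]_n) := [set z | overlap a b z.1].

Lemma overlapT_open a b : open (overlapT a b).
Proof. by apply: open_fst; exact: overlap_open. Qed.

Lemma smooth_trans_fst a b k : atlas M a -> atlas M b ->
  Ck k (overlapT a b) (fun z => trans a b z.1).
Proof.
move=> aM bM.
apply: (@Ck_comp _ _ _ _ (coords_rV n) k _ (overlap a b) (trans a b) fst) => //.
- exact: overlapT_open.
- exact: overlap_open.
- exact: Ck_fst.
- exact: smooth_trans.
Qed.

(** The moving direction [z.2] is expanded in the standard basis, which leaves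
    derivatives in fixed directions only. *)
Lemma smooth_tmap a b k : atlas M a -> atlas M b ->
  Ck k (overlapT a b) (fun z => 'D_(z.2) (trans a b) z.1).
Proof.
move=> aM bM; have oT := @overlapT_open a b.
apply: (@Ck_eq _ _ _ _ _ (fun z : 'rV[R]_n * 'rV[R]_n => \sum_(i < n)
    (z.2 0 i : R^o) *: 'D_(delta_mx 0 i) (trans a b) z.1)) => //.
  move=> z abz; rewrite (diff_linear_sum (coords_rV n)) //.
  exact: differentiable_trans.
apply: Ck_sum => // i _; apply: Ck_scale => //.
  apply: (Ck_lin_comp (l := rvfun i)) => //; first exact: rvfun_continuous.
  by apply: Ck_lin; exact: snd_continuous.
apply: (@Ck_comp _ _ _ _ (coords_rV n) k _ (overlap a b) ('D_(delta_mx 0 i) (trans a b)) fst) => //.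
- exact: overlap_open.
- exact: Ck_fst.
- by have [_] := smooth_trans k.+1 aM bM; exact.
Qed.

Lemma smooth_ttrans a b k : atlas M a -> atlas M b ->
  Ck k (overlapT a b) (ttrans a b).
Proof.
move=> aM bM; apply: Ck_pair; first exact: overlapT_open.
  exact: smooth_trans_fst.
exact: smooth_tmap.
Qed.

Lemma differentiable_ttrans a b z : atlas M a -> atlas M b ->
  overlapT a b z -> differentiable (ttrans a b) z.
Proof. by move=> aM bM; have [+ _] := smooth_ttrans 1 aM bM; exact. Qed.

Lemma ttrans_map a b q y : cdom a q ->
  ttrans a b (cmap a q, y) = (cmap b q, tmap a b q y).
Proof. by move=> aq; rewrite /ttrans /= trans_map. Qed.

(** The same for natural charts of the tangent bundle: [tcomp c u] is
    [ttmap (chart_at q) c q y] at [u = (q, y)]. *)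
Definition ttmap a b q y w : 'rV[R]_n * 'rV[R]_n := 'D_w (ttrans a b) (cmap a q, y).

Lemma ttmap_linear a b q y : atlas M a -> atlas M b -> cdom a q -> cdom b q ->
  linear (ttmap a b q y).
Proof.
move=> aM bM aq bq.
have d : differentiable (ttrans a b) (cmap a q, y).
  by apply: differentiable_ttrans => //; exact: overlap_map.
by move=> k w w'; rewrite /ttmap !deriveE // linearP.
Qed.

Lemma ttmap_id a q y w : atlas M a -> cdom a q -> ttmap a a q y w = w.
Proof.
move=> aM aq; rewrite /ttmap (near_eq_derive _ (g := id)) ?derive_id //.
apply: (open_eq_near (@overlapT_open a a)); first exact: overlap_map.
move=> [x y'] [p [ap _] /= <-]; rewrite ttrans_map // tmap_id //.
Qed.

Lemma ttmap_comp a b c q y w : atlas M a -> atlas M b -> atlas M c ->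
  cdom a q -> cdom b q -> cdom c q ->
  ttmap b c q (tmap a b q y) (ttmap a b q y w) = ttmap a c q y w.
Proof.
move=> aM bM cM aq bq cq.
have dab : differentiable (ttrans a b) (cmap a q, y).
  by apply: differentiable_ttrans => //; exact: overlap_map.
have dbc : differentiable (ttrans b c) (ttrans a b (cmap a q, y)).
  by rewrite ttrans_map //; apply: differentiable_ttrans => //; exact: overlap_map.
rewrite /ttmap [RHS](near_eq_derive _ (g := ttrans b c \o ttrans a b)); last first.
  have oabc : open ([set z | (cmap a @` (cdom a `&` (cdom b `&` cdom c))) z.1]
     : set ('rV[R]_n * 'rV[R]_n)).
    by apply: open_fst; exact: image_open (openI (cdom_open b) (cdom_open c)).
  apply: open_eq_near oabc _ _; first by exists q.
  move=> [x y'] [p [ap [bp cp]] Ex].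
  have -> : (x, y') = (cmap a p, y') by congr (_, _); exact/esym.
  rewrite [LHS](ttrans_map c y' ap) [RHS]/comp (ttrans_map b y' ap).
  by rewrite (ttrans_map c _ bp) (tmap_comp y' aM bM cM ap bp cp).
by rewrite [RHS](derive_comp w dab dbc) (ttrans_map b y aq).
Qed.

Lemma ttmap_fst a b q y w : atlas M a -> atlas M b -> cdom a q -> cdom b q ->
  (ttmap a b q y w).1 = tmap a b q w.1.
Proof.
move=> aM bM aq bq.
have d : differentiable (ttrans a b) (cmap a q, y).
  by apply: differentiable_ttrans => //; exact: overlap_map.
have dt := differentiable_trans aM bM (overlap_map aq bq).
have df : differentiable (fst : 'rV[R]_n * 'rV[R]_n -> _) (cmap a q, y).
  by apply: linear_differentiable; exact: fst_continuous.
rewrite /ttmap -(derive_fst_comp w d).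
have E1 : 'D_w fst (cmap a q, y) = w.1.
  by rewrite deriveE // diff_lin //; exact: fst_continuous.
by rewrite [LHS](derive_comp w df dt) E1.
Qed.

(** The transition map of natural charts is linear along the fibres. *)
Lemma ttmap_vertical a b q y v : atlas M a -> atlas M b -> cdom a q -> cdom b q ->
  ttmap a b q y (0, v) = (0, tmap a b q v).
Proof.
move=> aM bM aq bq; rewrite /ttmap derive_snd.
have L := tmap_linear aM bM aq bq.
apply: derive_affine => h; rewrite !ttrans_map // L.
by congr (_, _); [rewrite /= subrr scaler0|rewrite /= addrK].
Qed.

End Charts.

(** * Smooth fields on the slit bundle *)

Section Reading.
Context {R : realType} {n : nat} {M : manifold R n}.
Implicit Types (c d : chart R n M) (u : slit M) (v y : 'rV[R]_n)
  (w : 'rV[R]_n * 'rV[R]_n).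

#[local] Hint Resolve chart_at_atlas mem_chart_at : core.

Lemma tchartE c u : tchart c (val u) =
  (cmap c (proj u), tmap (chart_at (proj u)) c (proj u) (val u).2).
Proof. by []. Qed.

Lemma vcompE c u v : vcomp c (proj u) v = tmap (chart_at (proj u)) c (proj u) v.
Proof. by []. Qed.

Lemma vcomp_id u v : vcomp (chart_at (proj u)) (proj u) v = v.
Proof. by rewrite vcompE tmap_id. Qed.

Lemma tchart_id u : tchart (chart_at (proj u)) (val u) =
  (cmap (chart_at (proj u)) (proj u), (val u).2).
Proof. by rewrite tchartE tmap_id. Qed.

Lemma tcompE c u w : tcomp c u w =
  ttmap (chart_at (proj u)) c (proj u) (val u).2 w.
Proof. by rewrite /tcomp tchart_id. Qed.

Lemma tcomp_id u w : tcomp (chart_at (proj u)) u w = w.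
Proof.
by rewrite tcompE ttmap_id.
Qed.

Lemma vcomp_linear c u : atlas M c -> cdom c (proj u) -> linear (vcomp c (proj u)).
Proof.
by move=> cM cu; apply: tmap_linear => //.
Qed.

Lemma tcomp_linear c u : atlas M c -> cdom c (proj u) -> linear (tcomp c u).
Proof.
move=> cM cu k w w'; rewrite !tcompE.
by apply: ttmap_linear => //.
Qed.

Lemma tcomp0 c u : atlas M c -> cdom c (proj u) -> tcomp c u 0 = 0.
Proof. by move=> cM cu; exact: linear_at0 (tcomp_linear cM cu). Qed.

Lemma tcompZ c u k w : atlas M c -> cdom c (proj u) ->
  tcomp c u (k *: w) = k *: tcomp c u w.
Proof. by move=> cM cu; exact: linear_scale (tcomp_linear cM cu). Qed.

Lemma tcompD c u w w' : atlas M c -> cdom c (proj u) ->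
  tcomp c u (w + w') = tcomp c u w + tcomp c u w'.
Proof. by move=> cM cu; exact: linear_add (tcomp_linear cM cu). Qed.

Lemma vcomp0 c u : atlas M c -> cdom c (proj u) -> vcomp c (proj u) 0 = 0.
Proof. by move=> cM cu; exact: linear_at0 (vcomp_linear cM cu). Qed.

Lemma tcomp_fst c u w : atlas M c -> cdom c (proj u) ->
  (tcomp c u w).1 = vcomp c (proj u) w.1.
Proof.
by move=> cM cu; rewrite tcompE vcompE ttmap_fst.
Qed.

Lemma tcomp_vertical c u v : atlas M c -> cdom c (proj u) ->
  tcomp c u (0, v) = (0, vcomp c (proj u) v).
Proof.
by move=> cM cu; rewrite tcompE vcompE ttmap_vertical.
Qed.

Lemma vcompK c u v : atlas M c -> cdom c (proj u) ->
  tmap c (chart_at (proj u)) (proj u) (vcomp c (proj u) v) = v.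
Proof.
by move=> cM cu; rewrite vcompE tmap_comp // tmap_id.
Qed.

Lemma vcomp_inj c u : atlas M c -> cdom c (proj u) -> injective (vcomp c (proj u)).
Proof. by move=> cM cu v v' E; rewrite -(vcompK v cM cu) E vcompK. Qed.

Lemma tcompK c u w : atlas M c -> cdom c (proj u) ->
  ttmap c (chart_at (proj u)) (proj u) (tchart c (val u)).2 (tcomp c u w) = w.
Proof.
by move=> cM cu; rewrite tcompE tchartE ttmap_comp // ttmap_id.
Qed.

Lemma tcomp_inj c u : atlas M c -> cdom c (proj u) -> injective (tcomp c u).
Proof. by move=> cM cu v v' E; rewrite -(tcompK v cM cu) E tcompK. Qed.

Lemma read_slit (W : zmodType) c u (f : slit M -> W) : atlas M c ->
  cdom c (proj u) -> read c f (tchart c (val u)) = f u.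
Proof.
move=> cM cu; rewrite /read.
have -> : tchart_inv c (tchart c (val u)) = val u.
  rewrite /tchart_inv tchartE /= cmapK //.
  have := vcompK (val u).2 cM cu; rewrite vcompE /tmap => ->.
  by rewrite [RHS]surjective_pairing.
by rewrite valK.
Qed.

Lemma tran_slit c u : atlas M c -> cdom c (proj u) -> tran c (tchart c (val u)).
Proof.
move=> cM cu; split; first by exists (proj u).
apply: contra (valP u) => /eqP E; apply/eqP.
have L := tmap_linear cM (chart_at_atlas _) cu (mem_chart_at (proj u)).
have E' : vcomp c (proj u) (val u).2 = 0 := E.
by rewrite -(vcompK (val u).2 cM cu) E' linear_at0.
Qed.

(** Every property of [read c] on [tran c] can thus be stated at a point of the
    slit bundle, where [read_slit] computes it. *)
Lemma slit_of c z : atlas M c -> tran c z ->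
  exists u, cdom c (proj u) /\ tchart c (val u) = z.
Proof.
move=> cM [[q cq E] z2]; set a := chart_at q.
have aM : atlas M a := chart_at_atlas q.
have aq : cdom a q := mem_chart_at q.
have nz : nonzero_tangent (q, tmap c a q z.2).
  apply: contra z2 => /eqP /= y0; apply/eqP.
  rewrite -[LHS](tmap_id _ cq) -(tmap_comp _ cM aM cM cq aq cq) y0.
  exact: linear_at0 (tmap_linear aM cM aq cq).
exists (Sub (q, tmap c a q z.2) nz); split; first by rewrite /proj SubK.
rewrite tchartE /proj SubK /= tmap_comp // tmap_id // E.
by case: (z).
Qed.

Lemma tran_open c : open (tran c).
Proof.
have -> : tran c = [set z | (cmap c @` cdom c) z.1] `&` [set z | z.2 != 0] by [].
apply: openI; first by apply: open_fst; exact: cran_open.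
exact: (open_snd (@open_neq0 R _)).
Qed.

Lemma smooth_read (W : normedModType R) c (F : slit M -> W) : atlas M c ->
  (forall u k, cdom c (proj u) -> exists N g,
    [/\ open N, N (tchart c (val u)), Ck k N g &
        forall u', cdom c (proj u') -> N (tchart c (val u')) ->
          F u' = g (tchart c (val u'))]) ->
  smooth (tran c) (read c F).
Proof.
move=> cM H k; apply: Ck_local => z /[dup] Tz /(slit_of cM) [u [cu E]].
have [N [g [oN Nu Cg Fg]]] := H u k cu.
exists (N `&` tran c); first by rewrite -E; split=> //; exact: tran_slit.
apply: (@Ck_eq _ _ _ _ _ g); last by apply: Ck_sub Cg; move=> ? [].
  by apply: openI => //; exact: tran_open.
move=> z' [Nz' /(slit_of cM) [u' [cu' E']]].
by rewrite -E' read_slit // Fg // E'.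
Qed.

Lemma smooth_read_global (W : normedModType R) c (F : slit M -> W) g : atlas M c ->
  (forall k, Ck k (tran c) g) ->
  (forall u, cdom c (proj u) -> F u = g (tchart c (val u))) ->
  smooth (tran c) (read c F).
Proof.
move=> cM Cg Fg; apply: smooth_read => // u k cu.
exists (tran c), g; split=> //; [exact: tran_open|exact: tran_slit|].
by move=> u' cu' _; exact: Fg.
Qed.

Lemma read_pvf_slit c u (Y : pvf M) : atlas M c -> cdom c (proj u) ->
  read_pvf c Y (tchart c (val u)) = vcomp c (proj u) (Y u).
Proof. by move=> cM cu; rewrite /read_pvf read_slit. Qed.

Lemma read_vf_slit c u (X : vf M) : atlas M c -> cdom c (proj u) ->
  read_vf c X (tchart c (val u)) = tcomp c u (X u).
Proof. by move=> cM cu; rewrite /read_vf read_slit. Qed.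

Lemma smooth_eta : smooth_pvf (@eta R n M).
Proof.
move=> c cM; apply: (@smooth_read_global _ _ _ snd) => // k.
by apply: Ck_lin; exact: snd_continuous.
Qed.

Lemma smooth_rho (X : vf M) : smooth_vf X -> smooth_pvf (rho X).
Proof.
move=> sX c cM; apply: (@smooth_read_global _ _ _ (fst \o read_vf c X)) => //.
  move=> k; apply: Ck_lin_comp; [exact: tran_open|exact: fst_continuous|].
  exact: sX.
by move=> u cu; rewrite /= read_vf_slit // tcomp_fst.
Qed.

Lemma smooth_gamma (Y : pvf M) : smooth_pvf Y -> smooth_vf (gamma Y).
Proof.
move=> sY c cM; apply: (@smooth_read_global _ _ _ (fun z => (0, read_pvf c Y z))) => //.
  by move=> k; apply: Ck_pair; [exact: tran_open|exact: Ck_cst|exact: sY].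
by move=> u cu; rewrite read_pvf_slit // -tcomp_vertical.
Qed.

Lemma smooth_pvf0 : smooth_pvf (fun _ : slit M => 0).
Proof.
move=> c cM; apply: (@smooth_read_global _ _ _ (fun=> 0)) => // [k|u cu].
  exact: Ck_cst.
exact: linear_at0 (vcomp_linear cM cu).
Qed.

End Reading.

(** * Global fields with prescribed values *)

Section Frame.
Context {R : realType} {n : nat} {M : manifold R n}.
Implicit Types (c d : chart R n M) (u : slit M) (v y : 'rV[R]_n).

#[local] Hint Resolve chart_at_atlas mem_chart_at : core.

(** The support of [b] is a closed cube in the range of [c].  Its image [K] in [M]
    is compact, hence closed because [M] is Hausdorff, and this is what makes
    extension by zero smooth. *)
Lemma bump_chart c (p : M) : cdom c p ->
  exists (b : 'rV[R]_n -> R) (K : set M),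
    [/\ forall k, Ck k setT (b : 'rV[R]_n -> R^o), b (cmap c p) = 1, closed K, K `<=` cdom c &
        forall q, cdom c q -> ~ K q -> b (cmap c q) = 0].
Proof.
move=> cp; set x0 := cmap c p.
have : nbhs x0 (cmap c @` cdom c).
  by apply: open_nbhs_nbhs; split; [exact: cran_open|exists p].
move=> /nbhs_ballP [e /= e0 He]; pose r := e / 2.
have r0 : 0 < r by rewrite divr_gt0.
pose K0 := [set v : 'rV[R]_n | forall i, `[x0 0 i - r, x0 0 i + r]%classic (v 0 i)].
have K0c : compact K0.
  by apply: (rV_compact (A := fun i => `[x0 0 i - r, x0 0 i + r]%classic)) =>
     i; exact: segment_compact.
have K0s : K0 `<=` cmap c @` cdom c.
  move=> v Kv; apply: He; split=> // i j; rewrite ord1.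
  have := Kv j; rewrite /= in_itv /= => /andP[l1 l2].
  rewrite /ball /= /ball_ /= ltr_norml.
  have : r < e by rewrite /r ltr_pdivrMr // ltr_pMr // ltrDl.
  by move=> ?; apply/andP; split; lra.
exists (fun x => box x0 r x * (box x0 r x0)^-1), (cinv c @` K0); split.
- move=> k; apply: (Ck_mul openT); [exact: Ck_box|exact: Ck_cst].
- by rewrite mulfV // box_center_neq0.
- apply: compact_closed; first exact: m_hausdorff.
  apply: continuous_compact K0c; apply: continuous_subspaceW K0s _.
  exact: cinv_continuous.
- by move=> _ [v Kv <-]; apply: cinv_mem; exact: K0s.
- move=> q cq Kq; have [->|/box_neq0 H] := eqVneq (box x0 r (cmap c q)) 0.
    by rewrite mul0r.
  case: Kq; exists (cmap c q); last exact: cmapK.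
  by move=> i; rewrite /= in_itv /=; apply: H; exact: ltW.
Qed.

(** The coordinate field [(v, 0)] of the natural chart [c], multiplied by [b] and
    extended by zero. *)
Definition hfield c (b : 'rV[R]_n -> R) v : vf M := fun u =>
  if `[< cdom c (proj u) >]
  then b (cmap c (proj u)) *:
       ttmap c (chart_at (proj u)) (proj u) (tchart c (val u)).2 (v, 0)
  else 0.

Lemma tcomp_hfield c d (b : 'rV[R]_n -> R) v u : atlas M c -> atlas M d ->
  cdom c (proj u) -> cdom d (proj u) ->
  tcomp d u (hfield c b v u) =
  b (cmap c (proj u)) *: ttmap c d (proj u) (tchart c (val u)).2 (v, 0).
Proof.
move=> cM dM cu du; rewrite /hfield asboolT //.
rewrite (tcompZ _ _ dM du) tcompE.
have E : (val u).2 = tmap c (chart_at (proj u)) (proj u) (tchart c (val u)).2.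
  by rewrite vcompK.
have aM := chart_at_atlas (proj u); have am := mem_chart_at (proj u).
by rewrite [in LHS]E (ttmap_comp _ _ cM aM dM cu am du).
Qed.

Lemma tchart_trans c d u : atlas M c -> atlas M d ->
  cdom c (proj u) -> cdom d (proj u) ->
  ttrans d c (tchart d (val u)) = tchart c (val u).
Proof.
move=> cM dM cu du; rewrite !tchartE (ttrans_map c _ du).
by rewrite (tmap_comp _ (chart_at_atlas _) dM cM (mem_chart_at _) du cu).
Qed.

(** Over the domain of [c] the field is the image of [b *: (v, 0)] under a
    transition map.  A point outside this domain is not in [K], so that the
    field vanishes around it. *)
Lemma smooth_hfield c (b : 'rV[R]_n -> R) v (K : set M) : atlas M c ->
  (forall k, Ck k setT (b : 'rV[R]_n -> R^o)) ->
  closed K -> K `<=` cdom c -> (forall q, cdom c q -> ~ K q -> b (cmap c q) = 0) ->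
  smooth_vf (hfield c b v).
Proof.
move=> cM Cb cK sK bK d dM; apply: smooth_read => // u k du.
have [cu|cu] := pselect (cdom c (proj u)).
- pose g z := b (trans d c z.1) *: 'D_(v, 0) (ttrans c d) (ttrans d c z).
  exists (overlapT d c), g; split.
  + exact: overlapT_open.
  + exact: overlap_map.
  + have oT := @overlapT_open _ _ _ d c; apply: Ck_scale => //.
      apply: (@Ck_comp _ _ _ _ (coords_rV n) k _ setT b) => //; first exact: openT.
      exact: smooth_trans_fst.
    apply: (@Ck_comp _ _ _ _ (coords_prod (coords_rV n) (coords_rV n)) k _
      (overlapT c d) ('D_(v, 0) (ttrans c d))) => //.
    * exact: overlapT_open.
    * move=> z [q [dq cq] E]; rewrite /overlapT /= /ttrans /= -E trans_map //.
      exact: overlap_map.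
    * exact: smooth_ttrans.
    * by have [_] := smooth_ttrans k.+1 cM dM; exact.
  + move=> u' du' [q [dq cq] Eq].
    have cu' : cdom c (proj u') by rewrite -(cmapK du') -[cmap _ _]Eq cmapK.
    rewrite (tcomp_hfield b v cM dM cu' du') /g (tchart_trans cM dM cu' du').
    have -> : trans d c (tchart d (val u')).1 = cmap c (proj u') := trans_map c du'.
    reflexivity.
- exists [set z | (cmap d @` (cdom d `&` ~` K)) z.1], (fun=> 0); split.
  + by apply: open_fst; apply: image_open; exact: closed_openC.
  + by exists (proj u); split=> // /sK.
  + exact: Ck_cst.
  + move=> u' du' [q [dq Kq] Eq].
    have Ku' : ~ K (proj u') by rewrite -(cmapK du') -[cmap _ _]Eq cmapK.
    rewrite /hfield; case: ifP => [/asboolP cu'|_]; last exact: tcomp0.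
    by rewrite bK // scale0r tcomp0.
Qed.

Lemma rho_hfield c (b : 'rV[R]_n -> R) v u : atlas M c -> rho (hfield c b v) u =
  if `[< cdom c (proj u) >]
  then b (cmap c (proj u)) *: tmap c (chart_at (proj u)) (proj u) v else 0.
Proof.
move=> cM; rewrite /rho /rho_at /hfield.
case: ifP => [/asboolP cu|_]; last reflexivity.
have <- := ttmap_fst (tchart c (val u)).2 (v, 0) cM (chart_at_atlas _) cu (mem_chart_at _).
reflexivity.
Qed.

(** Connections are only constrained on globally defined smooth fields; these
    fields are numerous enough to recover pointwise statements from that.  As
    [b] is 1 on the whole fibre over [p], they are coordinate fields there. *)
Lemma exists_frame c (p : M) : atlas M c -> cdom c p ->
  exists (b : 'rV[R]_n -> R) (H : 'rV[R]_n -> vf M),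
    [/\ forall k, Ck k setT (b : 'rV[R]_n -> R^o), b (cmap c p) = 1,
        forall v, smooth_vf (H v),
        forall v u, cdom c (proj u) ->
          tcomp c u (H v u) = b (cmap c (proj u)) *: (v, 0) &
        forall v u u', proj u = proj u' -> rho (H v) u = rho (H v) u'].
Proof.
move=> cM cp; have [b [K [Cb b1 cK sK bK]]] := bump_chart cp.
exists b, (hfield c b); split.
- exact: Cb.
- exact: b1.
- by move=> v; exact: smooth_hfield Cb cK sK bK.
- move=> v u cu; rewrite (tcomp_hfield b v cM cM cu cu).
  by rewrite (ttmap_id _ _ cM cu).
- move=> v u u' E; rewrite (rho_hfield b v u cM) (rho_hfield b v u' cM) E.
  reflexivity.
Qed.

End Frame.

(** * Smoothness of the horizontal map *)

Section Horizontal.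
Context {R : realType} {n : nat} {M : manifold R n}.
Variable D : covder M.
Hypotheses (hlin : linear_connection D) (hreg : regular D).
Implicit Types (c : chart R n M) (u : slit M) (v a : 'rV[R]_n)
  (w : 'rV[R]_n * 'rV[R]_n).

#[local] Hint Resolve chart_at_atlas mem_chart_at : core.

Lemma K_linear u : linear (connection_map D u).
Proof. exact: (conn_linear hlin u smooth_eta). Qed.

Lemma beta_atP u v :
  connection_map D u (beta_at D u v) = 0 /\ (beta_at D u v).1 = v.
Proof.
have ex : exists w, [set w | connection_map D u w = 0 /\ rho_at w = v] w.
  have [/(_ (v, 0)) [a [b [va Kb E]]] _] := hreg u.
  exists b; split; first exact: Kb.
  have E1 : v = a.1 + b.1 := congr1 fst E.
  have va1 : a.1 = 0 := va.
  by rewrite E1 va1 add0r.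
exact: (xgetPex 0 ex).
Qed.

Lemma beta_at_uniq u v w :
  connection_map D u w = 0 -> w.1 = v -> w = beta_at D u v.
Proof.
move=> Kw wv; have [Kb bv] := beta_atP u v.
have [_ /(_ (w - beta_at D u v)) H] := hreg u.
apply/eqP; rewrite -subr_eq0; apply/eqP; apply: H.
  have E : (w - beta_at D u v).1 = w.1 - (beta_at D u v).1 by [].
  by rewrite /vertical /rho_at E wv bv subrr.
rewrite addrC -scaleN1r (K_linear u (-1)) Kw Kb scaler0 addr0.
reflexivity.
Qed.

Lemma rho_beta (X : pvf M) : rho (beta D X) = X.
Proof. by apply/funext => u; have [] := beta_atP u (X u). Qed.

(** In a chart the horizontal lift of [xi] is [(xi, a)], where [a] solves the
    linear system [K (xi, a) = 0].  Regularity says that the matrix of [K] on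
    vertical vectors is invertible, and Cramer's rule makes [a] smooth.  The
    frame [H] is what gives access to the coefficients of [K]. *)
Lemma smooth_beta (X : pvf M) : smooth_pvf X -> smooth_vf (beta D X).
Proof.
move=> sX c cM; apply: smooth_read => // u0 k cu0.
have [b [H [Cb b1 sH tH _]]] := exists_frame cM cu0.
pose e (i : 'I_n) : 'rV[R]_n := delta_mx 0 i.
pose kH i := nabla D (H (e i)) (@eta R n M).
pose kV i := nabla D (gamma (rho (H (e i)))) (@eta R n M).
have skH i : smooth_pvf (kH i).
  refine (conn_smooth hlin (sH (e i)) _); exact: smooth_eta.
have skV i : smooth_pvf (kV i).
  apply: (conn_smooth hlin); last exact: smooth_eta.
  by apply: smooth_gamma; apply: smooth_rho.
(* In the chart [c], [s] is K applied to the horizontal field [H xi], and the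
   rows of [N] are K applied to the vertical lifts of the [rho (H (e i))]; the
   factors [b] compensate for the damping of the frame. *)
pose xi z := read_pvf c X z.
pose N z : 'M[R]_n := \matrix_(i, j) read_pvf c (kV i) z 0 j.
pose s z : 'rV[R]_n := \sum_i xi z 0 i *: read_pvf c (kH i) z.
pose a z : 'rV[R]_n := - (b z.1)^-1 *: (s z *m invmx (N z)).
pose g z := (xi z, b z.1 *: a z).
have Hlin u : cdom c (proj u) -> linear (fun v => H v u).
  move=> cu l v v'; apply: (tcomp_inj cM cu).
  rewrite (tcompD _ _ cM cu) (tcompZ _ _ cM cu) !tH // scalerA mulrC -scalerA -scalerDr.
  by congr (_ *: (_, _)); rewrite /= scaler0 addr0.
have KH u : cdom c (proj u) ->
    linear (fun v => vcomp c (proj u) (connection_map D u (H v u))).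
  move=> cu l v v'; rewrite (Hlin u cu) (K_linear u) (vcomp_linear cM cu).
  reflexivity.
have Vlin u : cdom c (proj u) ->
    linear (fun v => vcomp c (proj u) (connection_map D u (gamma_at (rho_at (H v u))))).
  move=> cu l v v'; rewrite (Hlin u cu).
  have -> : gamma_at (rho_at (l *: H v u + H v' u)) =
     l *: gamma_at (rho_at (H v u)) + gamma_at (rho_at (H v' u)).
    by congr (_, _); rewrite /= scaler0 addr0.
  rewrite (K_linear u) (vcomp_linear cM cu).
  reflexivity.
have sE u : cdom c (proj u) ->
   s (tchart c (val u)) = vcomp c (proj u) (connection_map D u (H (xi (tchart c (val u))) u)).
  move=> cu; rewrite (linear_rV_sum _ (KH u cu)); apply: eq_bigr => i _.
  by rewrite read_pvf_slit.
have NE u v : cdom c (proj u) ->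
   v *m N (tchart c (val u)) = vcomp c (proj u) (connection_map D u (gamma_at (rho_at (H v u)))).
  move=> cu; rewrite (linear_rV_sum _ (Vlin u cu)) mulmx_sum_row; apply: eq_bigr => i _.
  congr (_ *: _); apply/rowP => j; rewrite !mxE read_pvf_slit //.
have Einj u v : cdom c (proj u) -> b (cmap c (proj u)) != 0 ->
    rho_at (H v u) = 0 -> v = 0.
  move=> cu bu Hv; have := tcomp_fst (H v u) cM cu.
  rewrite tH // -/(rho_at (H v u)) Hv (vcomp0 cM cu) /= => /eqP.
  by rewrite scaler_eq0 (negbTE bu) => /eqP.
have Nunit u : cdom c (proj u) -> b (cmap c (proj u)) != 0 -> N (tchart c (val u)) \in unitmx.
  move=> cu bu; rewrite -row_free_unit; apply: inj_row_free => v.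
  rewrite NE // -[RHS](vcomp0 cM cu) => /(vcomp_inj cM cu) Kv.
  apply: (Einj u v cu bu).
  have [_ /(_ (gamma_at (rho_at (H v u)))) Hr] := hreg u.
  have V0 : gamma_at (rho_at (H v u)) = 0.
    by apply: Hr Kv; rewrite /vertical /rho_at.
  exact: (congr1 snd V0).
have oN : open (tran c `&` [set z : 'rV[R]_n * 'rV[R]_n | b z.1 != 0]).
  apply: openI; first exact: tran_open.
  apply: (open_fst (A := [set x | b x != 0])).
  have cb : continuous (b : 'rV[R]_n -> R^o) by move=> x; exact: (Cb 0%N x I).
  by move/continuousP: cb => /(_ _ (@open_neq0 R R^o)).
exists (tran c `&` [set z | b z.1 != 0]), g; split.
- exact: oN.
- split; first exact: tran_slit.
  by rewrite /= b1 oner_neq0.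
- have sub : tran c `&` [set z | b z.1 != 0] `<=` tran c by move=> z [].
  have CY Y : smooth_pvf Y -> Ck k (tran c `&` [set z | b z.1 != 0]) (read_pvf c Y).
    by move=> sY; apply: Ck_sub sub _; exact: sY.
  have Cbf : Ck k (tran c `&` [set z : 'rV[R]_n * 'rV[R]_n | b z.1 != 0]) (fun z => b z.1 : R^o).
    apply: (@Ck_comp _ _ _ _ (coords_rV n) k _ setT (b : 'rV[R]_n -> R^o) fst) => //.
      exact: openT.
    exact: Ck_fst.
  apply: Ck_pair => //; first exact: CY.
  apply: (Ck_scale (f := fun z => b z.1)) => //.
  apply: (@Ck_eq _ _ _ _ _ (fun z =>
    (-1 : R^o) *: (((b z.1)^-1 : R^o) *: (s z *m invmx (N z))))) => //.
    by move=> z _; rewrite /a !scaleNr scale1r.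
  apply: Ck_scale => //; first exact: Ck_cst.
  apply: Ck_scale => //; first by apply: Ck_inv => // z [].
  apply: Ck_rV => // j.
  apply: (@Ck_eq _ _ _ _ _ (fun z => \sum_i (s z 0 i * invmx (N z) i j : R^o))) => //.
    by move=> z _; rewrite mxE.
  apply: Ck_sum => // i _; apply: Ck_mul => //.
    apply: Ck_rV_coord => //; apply: Ck_sum => // l _; apply: Ck_scale => //.
      by apply: Ck_rV_coord => //; exact: CY _ sX.
    exact: CY _ (skH l).
  apply: Ck_invmx => //.
    move=> i' j'; apply: (@Ck_eq _ _ _ _ _ (fun z => read_pvf c (kV i') z 0 j' : R^o)) => //.
      by move=> z _; rewrite mxE.
    apply: Ck_rV_coord => //; exact: CY _ (skV i').
  by move=> z [/(slit_of cM) [u [cu <-]] bz]; apply: Nunit.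
- move=> u cu [_ bu]; set z := tchart c (val u).
  have bu' : b (cmap c (proj u)) != 0 := bu.
  pose w : 'rV[R]_n * 'rV[R]_n := (b z.1)^-1 *: H (xi z) u + gamma_at (rho_at (H (a z) u)).
  have Tw : tcomp c u w = (xi z, b z.1 *: a z).
    rewrite (tcompD _ _ cM cu) (tcompZ _ _ cM cu) (tH _ _ cu) (tcomp_vertical _ cM cu).
    rewrite -(tcomp_fst (H (a z) u) cM cu) (tH _ _ cu) scalerA mulVf //.
    by congr (_, _); rewrite /= ?scaler0 ?scale1r ?addr0 ?add0r.
  have Ew : w = beta_at D u (X u).
    apply: beta_at_uniq.
      apply: (vcomp_inj cM cu).
      rewrite (K_linear u) (vcomp_linear cM cu) (vcomp0 cM cu) -(sE u cu) -(NE u _ cu).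
      rewrite /a -scalemxAl -mulmxA mulVmx ?Nunit // mulmx1 scaleNr.
      by rewrite addrN.
    apply: (vcomp_inj cM cu); rewrite -(tcomp_fst w cM cu) Tw /=.
    exact: read_pvf_slit.
  by rewrite /beta -Ew Tw.
Qed.

End Horizontal.

(** * Restriction to the fibres *)

Section Fibre.
Context {R : realType} {n : nat} {M : manifold R n}.
Implicit Types (c : chart R n M) (u : slit M) (v y : 'rV[R]_n) (p : M).

(** [f] along the fibre over [p], in the components of [chart_at p]; the default
    value 0 occurs only at the zero vector. *)
Definition fibre (W : zmodType) (f : slit M -> W) p y : W :=
  oapp f 0 (insub (p, y)).

Lemma fibre_val (W : zmodType) (f : slit M -> W) u :
  fibre f (proj u) (val u).2 = f u.
Proof.
rewrite /fibre; have -> : (proj u, (val u).2) = val u by rewrite [RHS]surjective_pairing.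
by rewrite valK.
Qed.

Lemma slit_at p y : y != 0 -> exists u : slit M, val u = (p, y).
Proof. by move=> y0; exists (exist _ (p, y) (y0 : nonzero_tangent (p, y))). Qed.

Lemma fibre_slit (W : zmodType) (f : slit M -> W) u p y : val u = (p, y) ->
  fibre f p y = f u.
Proof. by move=> E; rewrite -(fibre_val f u) /proj E. Qed.

Lemma read_fibre (W : zmodType) (f : slit M -> W) p y :
  read (chart_at p) f (cmap (chart_at p) p, y) = fibre f p y.
Proof.
rewrite /read /fibre.
have -> // : tchart_inv (chart_at p) (cmap (chart_at p) p, y) = (p, y).
rewrite /tchart_inv /= cmapK; last exact: mem_chart_at.
by congr (_, _); exact: (tmap_id y (mem_chart_at p)).
Qed.

Lemma tderive_vertical u v (f : sfun M) :
  tderive u (0, v) f = 'D_v (fibre f (proj u) : 'rV[R]_n -> R^o) (val u).2.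
Proof.
rewrite /tderive tchart_id derive_snd.
have E : (fun y => read (chart_at (proj u)) f (cmap (chart_at (proj u)) (proj u), y)) =
    fibre f (proj u) by apply/funext => y; exact: read_fibre.
rewrite E; reflexivity.
Qed.

Lemma smooth_fibre_read (W : normedModType R) (F : 'rV[R]_n * 'rV[R]_n -> W) p k :
  smooth (tran (chart_at p)) F ->
  Ck k [set y | y != 0] (fun y => F (cmap (chart_at p) p, y)).
Proof.
move=> sF.
apply: (@Ck_comp _ _ _ _ (coords_prod (coords_rV n) (coords_rV n)) k _
  (tran (chart_at p)) F (fun y => (cmap (chart_at p) p, y))).
- exact: open_neq0.
- exact: tran_open.
- by move=> y y0; split=> //; exists p => //; exact: mem_chart_at.
- apply: Ck_pair; first exact: open_neq0.
    exact: Ck_cst.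
  have ci : continuous (idfun : {linear 'rV[R]_n -> 'rV[R]_n}) by move=> x; exact: cvg_id.
  exact: (Ck_lin k _ ci).
- exact: sF.
Qed.

Lemma smooth_fibre_pvf (Y : pvf M) p k : smooth_pvf Y ->
  Ck k [set y | y != 0] (fibre Y p).
Proof.
move=> sY; have := smooth_fibre_read k (sY _ (chart_at_atlas p)).
apply: Ck_eq => [|y y0]; first exact: open_neq0.
rewrite /read_pvf read_fibre; have [u E] := slit_at p y0.
by rewrite !(fibre_slit _ E) -{1}(congr1 fst E : proj u = p) vcomp_id.
Qed.

Lemma smooth_fibre_fun (f : sfun M) p k : smooth_fun f ->
  Ck k [set y | y != 0] (fibre f p : 'rV[R]_n -> R^o).
Proof.
move=> sf; have := smooth_fibre_read k (sf _ (chart_at_atlas p)).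
apply: Ck_eq => [|y y0]; first exact: open_neq0.
by rewrite read_fibre.
Qed.

Lemma fibre_eta p y : y != 0 -> fibre (@eta R n M) p y = y.
Proof. by move=> /(slit_at p) [u E]; rewrite (fibre_slit _ E) /eta E. Qed.

Lemma near_neq0 y : y != 0 -> \forall y' \near y, y' != 0.
Proof. by move=> y0; apply: open_nbhs_nbhs; split=> //; exact: open_neq0. Qed.

(** Sections that are pulled back from vector fields on [M]. *)
Definition basic (Y : pvf M) := forall u u', proj u = proj u' -> Y u = Y u'.

Lemma derive_fibre_basic (Y : pvf M) v u : basic Y ->
  'D_v (fibre Y (proj u)) (val u).2 = 0.
Proof.
move=> bY; rewrite -[RHS](derive_cst (Y u) (val u).2 v); apply: near_eq_derive.
apply: filterS (near_neq0 (valP u : (val u).2 != 0)) => y y0.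
have [u' E] := slit_at (proj u) y0.
by rewrite (fibre_slit _ E); apply: bY; rewrite /proj E.
Qed.

Lemma exists_hfield p : exists H : 'rV[R]_n -> vf M,
  [/\ forall v, smooth_vf (H v), forall v u, proj u = p -> H v u = (v, 0) &
      forall v, basic (rho (H v))].
Proof.
have [b [H [_ b1 sH tH bH]]] := exists_frame (chart_at_atlas p) (mem_chart_at p).
exists H; split=> // v u E; subst p.
by rewrite -[LHS](tcomp_id u) (tH _ _ (mem_chart_at _)) b1 scale1r.
Qed.

Definition hlift p : 'rV[R]_n -> vf M := sval (cid (exists_hfield p)).

(** The test section at the points over [p]: it has the value [v] on the whole fibre
    over [p] and is constant along every fibre. *)
Definition lift p v : pvf M := rho (hlift p v).

Lemma smooth_hlift p v : smooth_vf (hlift p v).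
Proof. by rewrite /hlift; case: cid => H []. Qed.

Lemma hlift_val p v u : proj u = p -> hlift p v u = (v, 0).
Proof. by rewrite /hlift; case: cid => H [] _ /= + _; exact. Qed.

Lemma smooth_lift p v : smooth_pvf (lift p v).
Proof. exact: smooth_rho (smooth_hlift p v). Qed.

Lemma lift_val p v u : proj u = p -> lift p v u = v.
Proof. by move=> E; rewrite /lift /rho /rho_at hlift_val. Qed.

Lemma basic_lift p v : basic (lift p v).
Proof. by rewrite /lift /hlift; case: cid => H []. Qed.

Lemma lift_self u v : lift (proj u) v u = v.
Proof. exact: lift_val. Qed.

End Fibre.

(** * The torsion in terms of fibre derivatives *)

Section Connection.
Context {R : realType} {n : nat} {M : manifold R n}.
Variable D : covder M.
Hypotheses (hlin : linear_connection D) (hreg : regular D).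
Implicit Types (c : chart R n M) (u : slit M) (v y : 'rV[R]_n) (p : M)
  (w : 'rV[R]_n * 'rV[R]_n).

Lemma conn0 u w : D u w (fun=> 0) = 0.
Proof.
have := conn_add hlin u w smooth_pvf0 smooth_pvf0.
have -> : (fun x : slit M => (0 : 'rV[R]_n) + 0) = (fun=> 0).
  by apply/funext => x; rewrite addr0.
by move/(congr1 (fun v => v - D u w (fun=> 0))); rewrite subrr addrK.
Qed.

Lemma rho_gamma (Y : pvf M) : rho (gamma Y) = (fun=> 0).
Proof. by []. Qed.

(** [gamma Y] has no horizontal component, so the only contribution is the
    derivative along the fibre of the horizontal component of [X]. *)
Lemma rho_bracket (X : vf M) (Y : pvf M) u : smooth_vf X -> smooth_pvf Y ->
  rho (bracket (gamma Y) X) u = 'D_(Y u) (fibre (rho X) (proj u)) (val u).2.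
Proof.
move=> sX sY; set c := chart_at (proj u); have cM : atlas M c := chart_at_atlas _.
have cu : cdom c (proj u) := mem_chart_at _.
set z := tchart c (val u).
have Tz : tran c z by exact: tran_slit.
have dX : differentiable (read_vf c X) z.
  have [dX _] := sX c cM 1%N.
  exact: (dX z Tz).
have dY : differentiable (read_vf c (gamma Y)) z.
  have sG : smooth_vf (gamma Y) by exact: smooth_gamma.
  have [dG _] := sG c cM 1%N.
  exact: (dG z Tz).
have EX := derive_fst_comp (gamma Y u) dX.
have EY := derive_fst_comp (X u) dY.
have -> : rho (bracket (gamma Y) X) u =
  ('D_(gamma Y u) (read_vf c X) z).1 - ('D_(X u) (read_vf c (gamma Y)) z).1 by [].
have EY0 : 'D_(X u) (fun z => (read_vf c (gamma Y) z).1) z = 0.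
  rewrite -[RHS](derive_cst (0 : 'rV[R]_n) z (X u)); apply: near_eq_derive.
  apply: (open_eq_near (@tran_open _ _ _ c) Tz) => z' /(slit_of cM) [u' [cu' <-]].
  rewrite (read_vf_slit (gamma Y) cM cu') (tcomp_vertical _ cM cu').
  reflexivity.
apply: etrans (congr2 (fun a b => a - b) (esym EX) (etrans (esym EY) EY0)) _.
rewrite subr0.
transitivity ('D_(gamma Y u) (read_pvf c (rho X)) z).
  apply: near_eq_derive.
  apply: (open_eq_near (@tran_open _ _ _ c) Tz) => z' /(slit_of cM) [u' [cu' <-]].
  by rewrite (read_vf_slit X cM cu') (read_pvf_slit (rho X) cM cu') (tcomp_fst _ cM cu').
rewrite /z tchart_id [LHS]derive_snd; apply: near_eq_derive.
apply: filterS (near_neq0 (valP u : (val u).2 != 0)) => y y0.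
rewrite /read_pvf read_fibre; have [u' E] := slit_at (proj u) y0.
by rewrite !(fibre_slit _ E) /c -(congr1 fst E : proj u' = proj u) vcomp_id.
Qed.

(** The term containing [rho (gamma Y) = 0] disappears, and the bracket contributes
    the derivative of [Z] along the fibre. *)
Lemma torsionT_E (Y Z : pvf M) u : smooth_pvf Y -> smooth_pvf Z ->
  torsionT D Y Z u = D u (gamma_at (Y u)) Z - 'D_(Y u) (fibre Z (proj u)) (val u).2.
Proof.
move=> sY sZ; rewrite /torsionT /torsion.
rewrite (rho_bracket u (smooth_beta hlin hreg sZ) sY) (rho_beta hreg Z).
have -> : nabla D (beta D Z) (rho (gamma Y)) u = 0 by exact: conn0.
by rewrite subr0.
Qed.

Lemma torsionT_basic (Y Z : pvf M) : smooth_pvf Y -> smooth_pvf Z -> basic Z ->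
  torsionT D Y Z = nabla D (gamma Y) Z.
Proof.
move=> sY sZ bZ; apply/funext => u.
by rewrite torsionT_E // derive_fibre_basic // subr0.
Qed.

End Connection.

(** * The metric and the Cartan tensor *)

Section Metric.
Context {R : realType} {n : nat} {M : manifold R n}.
Variable L : tangent M -> R.
Hypothesis hL : finsler L.
Implicit Types (u : slit M) (v w z y : 'rV[R]_n) (p : M).

(** Twice the metric is the Hessian of this function. *)
Definition energy p : 'rV[R]_n -> R^o := fun y => L (p, y) ^+ 2.

Lemma smooth_energy p k : Ck k [set y | y != 0] (energy p).
Proof.
have CL := smooth_fibre_fun p k (finsler_smooth hL).
apply: Ck_eq (Ck_mul (@open_neq0 R _) CL CL); first exact: open_neq0.
by move=> y /(slit_at p) [u E]; rewrite (fibre_slit _ E) E /energy expr2.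
Qed.

Lemma smooth_energy1 p w k : Ck k [set y | y != 0] ('D_w (energy p)).
Proof. by have [_] := smooth_energy p k.+1; exact. Qed.

Lemma smooth_energy2 p v w k : Ck k [set y | y != 0] ('D_v ('D_w (energy p))).
Proof. by have [_] := smooth_energy1 p w k.+1; exact. Qed.

Lemma fmetricE u v w :
  fmetric L u v w = 2^-1 * 'D_v ('D_w (energy (proj u))) (val u).2.
Proof. by []. Qed.

Lemma slit_neq0 u : (val u).2 != 0.
Proof. exact: (valP u). Qed.

Lemma fmetric_sym u v w : fmetric L u v w = fmetric L u w v.
Proof.
have E := schwarz v w (@open_neq0 R _) (slit_neq0 u) (smooth_energy (proj u) 2).
exact: (congr1 (fun x => 2^-1 * x) E).
Qed.

Lemma fmetric_linear u w k v v' :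
  fmetric L u (k *: v + v') w = k * fmetric L u v w + fmetric L u v' w.
Proof.
have d := Ck_differentiable (smooth_energy1 (proj u) w 1) (slit_neq0 u).
rewrite !fmetricE !(deriveE _ d) linearP mulrDr [X in X + _]mulrCA.
reflexivity.
Qed.

Lemma fmetric0 u w : fmetric L u 0 w = 0.
Proof.
by have := fmetric_linear u w (-1) 0 0; rewrite scaler0 addr0 mulN1r addNr.
Qed.

Lemma fmetric0r u w : fmetric L u w 0 = 0.
Proof. by rewrite fmetric_sym fmetric0. Qed.

Lemma fmetricN u v w : fmetric L u (- v) w = - fmetric L u v w.
Proof.
by have := fmetric_linear u w (-1) v 0; rewrite addr0 scaleN1r mulN1r fmetric0 addr0.
Qed.

Lemma fmetric_nondeg u v : (forall z, fmetric L u v z = 0) -> v = 0.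
Proof.
move=> H; have [//|/(finsler_posdef hL u)] := eqVneq v 0.
by rewrite H ltxx.
Qed.

Lemma fmetric_inj u v w : (forall z, fmetric L u v z = fmetric L u w z) -> v = w.
Proof.
move=> H; apply/eqP; rewrite -subr_eq0; apply/eqP; apply: (@fmetric_nondeg u) => z.
by rewrite -[v]scale1r fmetric_linear fmetricN H mul1r addrN.
Qed.

Lemma fmetric_coord u v w :
  fmetric L u v w =
  \sum_i \sum_j v 0 i * (w 0 j * fmetric L u (delta_mx 0 i) (delta_mx 0 j)).
Proof.
have Lv : linear (fun v => fmetric L u v w : R^o) by move=> k v1 v2; exact: fmetric_linear.
have Lw i : linear (fun w => fmetric L u (delta_mx 0 i) w : R^o).
  by move=> k w1 w2; rewrite ![fmetric L u (delta_mx 0 i) _]fmetric_sym; exact: fmetric_linear.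
rewrite [LHS](linear_rV_sum v Lv); apply: eq_bigr => i _.
by rewrite [fmetric _ _ _ _](linear_rV_sum w (Lw i)) -mulr_sumr.
Qed.

Definition third p v w z y : R := 'D_v ('D_w ('D_z (energy p))) y.

Lemma third_sym12 p v w z y : y != 0 -> third p v w z y = third p w v z y.
Proof.
by move=> y0; apply: schwarz (@open_neq0 R _) y0 (smooth_energy1 p z 2).
Qed.

Lemma smooth_third p v w z k : Ck k [set y | y != 0] (third p v w z : 'rV[R]_n -> R^o).
Proof. by have [_] := smooth_energy2 p w z k.+1; exact. Qed.

Lemma fourth_swap p a v w z y : y != 0 ->
  'D_a (third p v w z : 'rV[R]_n -> R^o) y = 'D_v (third p a w z : 'rV[R]_n -> R^o) y.
Proof.
by move=> y0; apply: schwarz (@open_neq0 R _) y0 (smooth_energy2 p w z 2).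
Qed.

Variable D : covder M.
Hypothesis hD : cartan_connection L D.

Let hlin := cartan_linear hD.
Let hreg := cartan_regular hD.

(** The vertical connection coefficients.  They turn out to be the components of
    the torsion T, see [torsionT_tensor]. *)
Definition cartan_tensor u v w := D u (gamma_at v) (lift (proj u) w).

Lemma conn_vertical_lift (Y : pvf M) p w u : proj u = p ->
  nabla D (gamma Y) (lift p w) u = cartan_tensor u (Y u) w.
Proof. by move=> <-. Qed.

Lemma fibre_metric_lift p w z y : y != 0 ->
  fibre (fun x => fmetric L x (lift p w x) (lift p z x)) p y =
  2^-1 * 'D_w ('D_z (energy p)) y.
Proof.
move=> /(slit_at p) [u E]; have Ep : proj u = p by rewrite /proj E.
rewrite (fibre_slit _ E) (lift_val w Ep) (lift_val z Ep) fmetricE Ep E.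
reflexivity.
Qed.

Lemma cartan_tensor_selfadj u v w z :
  fmetric L u (cartan_tensor u v w) z = fmetric L u (cartan_tensor u v z) w.
Proof.
set p := proj u.
have H := @cartan_T _ _ _ _ _ hD _ _ _ (smooth_lift p v) (smooth_lift p w) (smooth_lift p z) u.
move: H; rewrite !(torsionT_basic hlin hreg (smooth_lift p v));
  try exact: smooth_lift; try exact: basic_lift.
rewrite !(conn_vertical_lift (lift p v) _ (erefl p)) !(lift_val _ (erefl p)) => H.
exact: H.
Qed.

(** Metric compatibility along [gamma v] writes the fibre derivative of [g(w, z)] as
    [g(C(v, w), z) + g(w, C(v, z))]; both terms agree by the symmetry axiom of
    T.  As [g] is half of a second derivative of [L^2], the factor is 1/4. *)
Lemma cartan_tensorE u v w z :
  fmetric L u (cartan_tensor u v w) z = 4^-1 * third (proj u) v w z (val u).2.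
Proof.
set p := proj u.
have H := @cartan_metric _ _ _ _ _ hD _ _ _ (smooth_gamma (smooth_lift p v))
  (smooth_lift p w) (smooth_lift p z) u.
have Ev : gamma (lift p v) u = (0, v) by rewrite /gamma lift_self.
move: H; rewrite !(conn_vertical_lift (lift p v) _ (erefl p)) !(lift_val _ (erefl p)).
rewrite Ev tderive_vertical.
rewrite [fmetric L u w _]fmetric_sym [fmetric L u _ w]cartan_tensor_selfadj.
have -> : 'D_v (fibre (fun x => fmetric L x (lift p w x) (lift p z x)) (proj u)) (val u).2 =
   2^-1 * third p v w z (val u).2.
  have d := Ck_differentiable (smooth_energy2 p w z 1) (slit_neq0 u).
  have E := @deriveZ R _ R^o ('D_w ('D_z (energy p))) 2^-1 (val u).2 v (diff_derivable d).
  apply: etrans E.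
  apply: near_eq_derive; apply: filterS (near_neq0 (slit_neq0 u)) => y y0.
  by rewrite -/p fibre_metric_lift.
move=> H; set x := fmetric _ _ _ _ in H *.
have -> : x = 2^-1 * (x + x) by lra.
rewrite -H; lra.
Qed.

Lemma cartan_tensor_sym u v w : cartan_tensor u v w = cartan_tensor u w v.
Proof.
apply: (@fmetric_inj u) => z; rewrite !cartan_tensorE third_sym12 //.
exact: slit_neq0.
Qed.

(** The symmetry axiom exchanges [W] with a test section in the argument that is
    differentiated, after which only the value of [W] at [u] matters. *)
Lemma torsionT_tensor (Y W : pvf M) u : smooth_pvf Y -> smooth_pvf W ->
  torsionT D Y W u = cartan_tensor u (Y u) (W u).
Proof.
move=> sY sW; apply: (@fmetric_inj u) => z; set p := proj u.
have := @cartan_T _ _ _ _ _ hD _ _ _ sY sW (smooth_lift p z) u.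
rewrite (torsionT_basic hlin hreg sY (smooth_lift p z) (basic_lift _ _)).
rewrite (conn_vertical_lift Y _ (erefl p)) (lift_val _ (erefl p)) => ->.
exact: cartan_tensor_selfadj.
Qed.

Lemma conn_vertical (Y W : pvf M) u : smooth_pvf Y -> smooth_pvf W ->
  nabla D (gamma Y) W u =
  'D_(Y u) (fibre W (proj u)) (val u).2 + cartan_tensor u (Y u) (W u).
Proof.
move=> sY sW; rewrite -torsionT_tensor // (torsionT_E hlin hreg) //.
by rewrite addrC subrK.
Qed.

Lemma cartan_tensor0l u w : cartan_tensor u 0 w = 0.
Proof.
apply: (linear_at0 (f := fun v => cartan_tensor u v w)) => k v v'.
rewrite /cartan_tensor -(conn_linear hlin u (smooth_lift (proj u) w)).
by congr (D u _ _); congr (_, _); rewrite /= scaler0 addr0.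
Qed.

Lemma cartan_tensor0r u w : cartan_tensor u w 0 = 0.
Proof. by rewrite cartan_tensor_sym cartan_tensor0l. Qed.

Lemma cartan_tensorNr u v w : cartan_tensor u v (- w) = - cartan_tensor u v w.
Proof.
apply: (@fmetric_inj u) => z.
rewrite fmetricN ![fmetric L u (cartan_tensor u v _) z]cartan_tensor_selfadj.
by rewrite fmetric_sym fmetricN fmetric_sym.
Qed.

End Metric.

(** * Concurrent sections annihilate the Cartan tensor *)

Section Concurrent.
Context {R : realType} {n : nat} {M : manifold R n}.
Variable L : tangent M -> R.
Hypothesis hL : finsler L.
Variable D : covder M.
Hypothesis hD : cartan_connection L D.
Variable zeta : pvf M.
Hypothesis hzeta : concurrent D zeta.
Implicit Types (u : slit M) (v w z y e : 'rV[R]_n) (p : M).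

Let hlin := cartan_linear hD.
Let hreg := cartan_regular hD.
Let sz : smooth_pvf zeta := hzeta.1.
Local Notation C := (cartan_tensor D).

Lemma conn_zeta_vertical u v : D u (gamma_at v) zeta = 0.
Proof.
have [_ H] := hzeta.2 _ (smooth_lift (proj u) v) u.
by rewrite -[v](lift_self u).
Qed.

(** The concurrence equations prescribe the derivative of [zeta] on horizontal and
    on vertical vectors, and every vector is a sum of two such. *)
Lemma conn_zeta u (x : 'rV[R]_n * 'rV[R]_n) : D u x zeta = - x.1.
Proof.
have [H _] := hzeta.2 _ (smooth_lift (proj u) x.1) u.
have [_ b1] := beta_atP hreg u x.1.
have E : x = 1 *: beta_at D u x.1 + gamma_at (x.2 - (beta_at D u x.1).2).
  rewrite scale1r [LHS]surjective_pairing [in RHS](surjective_pairing (beta_at D u x.1)).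
  by rewrite b1; congr (_, _); rewrite /= ?addr0 // addrC subrK.
rewrite {1}E (conn_linear hlin u sz) conn_zeta_vertical addr0 scale1r.
by move: H; rewrite /nabla /beta lift_self.
Qed.

Definition znorm : sfun M := fun u => fmetric L u (zeta u) (zeta u).

Lemma smooth_fibre_znorm p k :
  Ck k [set y | y != 0] (fibre znorm p : 'rV[R]_n -> R^o).
Proof.
have oU := @open_neq0 R 'rV[R]_n.
have Cz := smooth_fibre_pvf p k sz.
apply: (@Ck_eq _ _ _ _ _ (fun y => \sum_i \sum_j (fibre zeta p y 0 i *
   (fibre zeta p y 0 j * (2^-1 * 'D_(delta_mx 0 i) ('D_(delta_mx 0 j) (energy L p)) y))) : R^o)).
- exact: oU.
- move=> y /(slit_at p) [u E]; rewrite (fibre_slit znorm E) (fibre_slit zeta E).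
  apply: etrans _ (esym (fmetric_coord hL u (zeta u) (zeta u))).
  apply: eq_bigr => i _; apply: eq_bigr => j _.
  rewrite fmetricE /proj E.
  reflexivity.
do 2 (apply: (@Ck_sum _ _ R^o _ _ _ _ _ _ oU) => ? _).
apply: (Ck_mul oU); first exact: Ck_rV_coord.
apply: (Ck_mul oU); first exact: Ck_rV_coord.
apply: (Ck_mul oU); first exact: Ck_cst.
exact: smooth_energy2.
Qed.

Lemma derive_fibre_znorm p v y : y != 0 ->
  'D_v (fibre znorm p : 'rV[R]_n -> R^o) y = 0.
Proof.
move=> /(slit_at p) [u E]; have Ep : proj u = p by rewrite /proj E.
have H := cartan_metric hD (smooth_gamma (smooth_lift (proj u) v)) sz sz u.
move: H; rewrite /nabla /gamma lift_self conn_zeta_vertical fmetric0 // fmetric0r // addr0.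
by rewrite tderive_vertical Ep E.
Qed.

Lemma znorm_segment p a b : avoids0 a b -> fibre znorm p b = fibre znorm p a.
Proof.
move=> ab; apply: (@segment_constant R 'rV[R]_n (fibre znorm p)) => t t01.
split; last exact: derive_fibre_znorm (ab t t01).
exact: Ck_differentiable (smooth_fibre_znorm p 1) (ab t t01).
Qed.

(** The chart [c] and the chart at the base point differ by a linear bijection of
    the fibre, which preserves the segments that avoid 0. *)
Lemma read_znorm_segment c x a b : atlas M c -> (cmap c @` cdom c) x ->
  avoids0 a b -> read c znorm (x, b) = read c znorm (x, a).
Proof.
move=> cM cx ab; set q := cinv c x.
have cq : cdom c q := cinv_mem cx.
have E y : read c znorm (x, y) = fibre znorm q (tmap c (chart_at q) q y).
  by rewrite /tmap (cinvK cx).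
have aM := chart_at_atlas q; have aq := mem_chart_at q.
have Tl := tmap_linear cM aM cq aq.
rewrite !E; apply: znorm_segment => t /ab; apply: contra => /eqP T0; apply/eqP.
have E0 : tmap c (chart_at q) q (a + t *: (b - a)) = 0.
  rewrite addrC Tl (linear_add _ _ Tl) -scaleN1r (linear_scale _ _ Tl) scaleN1r addrC.
  exact: T0.
by rewrite -(tmap_id (a + t *: (b - a)) cq) -(tmap_comp _ cM aM cM cq aq cq) E0
  (linear_at0 (tmap_linear aM cM aq cq)).
Qed.

(** By [conn_zeta], the differential of [g(zeta, zeta)] is [-2 g(rho, zeta)]; here
    it is evaluated at the coordinate vector [(e, 0)]. *)
Lemma zeta_cometric u e : fmetric L u e (zeta u) =
  - 2^-1 * 'D_e (fun x => read (chart_at (proj u)) znorm (x, (val u).2) : R^o)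
     (cmap (chart_at (proj u)) (proj u)).
Proof.
have H := cartan_metric hD (smooth_hlift (proj u) e) sz sz u.
move: H; rewrite /nabla (hlift_val _ erefl) conn_zeta /= fmetricN //.
rewrite (fmetric_sym hL u (zeta u) (- e)) (fmetricN hL) (fmetric_sym hL u e).
rewrite /tderive tchart_id derive_fst => ->.
rewrite -/znorm; set x := fmetric _ _ _ _; lra.
Qed.

(** [g(zeta, zeta)] is locally independent of the fibre coordinate, at all base
    points near the given one; hence so is its derivative along [(e, 0)]. *)
Lemma zeta_cometric_near u e :
  \forall y \near (val u).2, forall u', val u' = (proj u, y) ->
    fmetric L u' e (zeta u') = fmetric L u e (zeta u).
Proof.
have y0 : (val u).2 != 0 := slit_neq0 u.
apply: filterS (avoids0_near y0) => y yy u' Eu'.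
have Ep : proj u' = proj u by rewrite /proj Eu'.
move: (zeta_cometric u' e); rewrite Ep Eu' => ->; rewrite (zeta_cometric u e).
apply: (congr1 (fun r => - 2^-1 * r)).
have cM := chart_at_atlas (proj u).
apply: near_eq_derive.
apply: (open_eq_near (cran_open (chart_at (proj u)))).
  by exists (proj u) => //; exact: mem_chart_at.
by move=> x cx; exact: read_znorm_segment.
Qed.

(** As [zeta] is parallel along the fibres, [g(C(v, e), zeta)] is the fibre derivative
    of [g(e, zeta)], which is 0 by [zeta_cometric_near].  The conclusion follows
    by symmetry of [g(C(v, w), z)] in [w] and [z]. *)
Lemma tensor_zeta u v : C u v (zeta u) = 0.
Proof.
apply: (@fmetric_nondeg _ _ _ _ hL u) => e.
rewrite (cartan_tensor_selfadj hD).
set p := proj u.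
have H := cartan_metric hD (smooth_gamma (smooth_lift p v)) (smooth_lift p e) sz u.
move: H; rewrite (conn_vertical_lift D (lift p v) _ (erefl p)) !(lift_val _ (erefl p)).
rewrite /nabla /gamma (lift_val _ (erefl p)) conn_zeta_vertical fmetric0r // addr0 => <-.
rewrite tderive_vertical.
rewrite -[RHS](derive_cst (fmetric L u e (zeta u) : R^o) (val u).2 v).
apply: near_eq_derive; apply: filterS2 (near_neq0 (slit_neq0 u)) (zeta_cometric_near u e).
move=> y /(slit_at p) [u' E] H.
have Ep : proj u' = p by rewrite /proj E.
rewrite (fibre_slit _ E) (lift_val e Ep).
exact: H.
Qed.

Lemma torsionT_zeta (Y : pvf M) : smooth_pvf Y -> torsionT D Y zeta = (fun=> 0).
Proof.
by move=> sY; apply/funext => u; rewrite (torsionT_tensor hL hD) // tensor_zeta.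
Qed.

Lemma derive_fibre_zeta p v y : y != 0 -> 'D_v (fibre zeta p) y = 0.
Proof.
move=> /(slit_at p) [u E]; have Ep : proj u = p by rewrite /proj E.
have := conn_vertical hL hD u (smooth_lift (proj u) v) sz.
rewrite /nabla /gamma lift_self conn_zeta_vertical tensor_zeta addr0 Ep E.
by move=> <-.
Qed.

(** Both the covariant derivative of [zeta] along the fibres and [C(v, zeta)] vanish,
    so the plain derivative of [zeta] does as well. *)
Lemma zeta_near p y : y != 0 -> {near y, fibre zeta p =1 (fun=> fibre zeta p y)}.
Proof.
move=> /avoids0_near; apply: filterS => y' yy'; apply/rowP => i.
apply: (@segment_constant R 'rV[R]_n (fun y => fibre zeta p y 0 i)) => t t01.
have nz := yy' t t01; have Cz := smooth_fibre_pvf p 1 sz.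
split.
  exact: Ck_differentiable (Ck_rV_coord i (@open_neq0 R _) Cz) nz.
have d := Ck_differentiable Cz nz.
have H := derive_lin_comp (l := rvfun i) (y' - y) (@rvfun_continuous R n i) d.
apply: etrans H _; rewrite derive_fibre_zeta //.
exact: mxE.
Qed.

End Concurrent.

(** * Recurrence forces the Cartan tensor to vanish *)

Section Recurrent.
Context {R : realType} {n : nat} {M : manifold R n}.
Variable L : tangent M -> R.
Hypothesis hL : finsler L.
Variable D : covder M.
Hypothesis hD : cartan_connection L D.
Implicit Types (u : slit M) (v w z y e : 'rV[R]_n) (p : M)
  (l : slit M -> 'rV[R]_n -> R).

Let hlin := cartan_linear hD.
Let hreg := cartan_regular hD.
Local Notation C := (cartan_tensor D).
Local Notation T := (torsionT D).

Definition tensor_free := forall u v w, C u v w = 0.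

Lemma torsionT_free (Y Z : pvf M) : tensor_free -> smooth_pvf Y -> smooth_pvf Z ->
  T Y Z = (fun=> 0).
Proof.
by move=> C0 sY sZ; apply/funext => u; rewrite (torsionT_tensor hL hD) // C0.
Qed.

Lemma smooth_conn (X : vf M) (Y : pvf M) : smooth_vf X -> smooth_pvf Y ->
  smooth_pvf (nabla D X Y).
Proof. by move=> sX sY; apply: (conn_smooth hlin). Qed.

Lemma free_recurrent (X : vf M) (Y Z : pvf M) u (a : R) : tensor_free ->
  smooth_vf X -> smooth_pvf Y -> smooth_pvf Z ->
  nabla12 (nabla D) X T Y Z u = a *: T Y Z u.
Proof.
move=> C0 sX sY sZ; rewrite /nabla12.
rewrite (torsionT_free C0 sY sZ) (torsionT_free C0 (smooth_conn sX sY) sZ).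
rewrite (torsionT_free C0 sY (smooth_conn sX sZ)) scaler0 !subr0.
exact: conn0.
Qed.

Lemma beta0 : beta D (fun=> 0) = (fun=> 0).
Proof.
apply/funext => u; rewrite /beta; apply/esym; apply: (beta_at_uniq hlin hreg) => //.
exact: linear_at0 (K_linear hlin u).
Qed.

Lemma conn_at0 u (Y : pvf M) : smooth_pvf Y -> D u 0 Y = 0.
Proof. by move=> sY; exact: linear_at0 (conn_linear hlin u sY). Qed.

Lemma bracket0 (Y : vf M) u : bracket (fun=> 0) Y u = 0.
Proof.
have E1 := derive0 (read_vf (chart_at (proj u)) Y) (tchart (chart_at (proj u)) (val u)).
have E2 : read_vf (chart_at (proj u)) (fun=> 0 : 'rV[R]_n * 'rV[R]_n) = (fun=> 0).
  apply/funext => x; rewrite /read_vf /read; case: insub => [u'|].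
    exact: derive0.
  reflexivity.
have E3 : 'D_(Y u) (read_vf (chart_at (proj u)) (fun=> 0)) (tchart (chart_at (proj u)) (val u)) = 0.
  rewrite E2; exact: derive_cst.
exact: etrans (congr2 (fun a b => a - b) E1 E3) (subr0 _).
Qed.

Lemma Phat0 (W : pvf M) u : smooth_pvf W -> Phat D (fun=> 0) W u = 0.
Proof.
move=> sW; rewrite /Phat /curvatureP beta0 /curvature.
have se := @smooth_eta R n M.
have -> : nabla D (fun=> 0) (@eta R n M) = (fun=> 0).
  by apply/funext => x; exact: conn_at0.
have -> : nabla D (bracket (fun=> 0) (gamma W)) (@eta R n M) u = 0.
  by rewrite /nabla bracket0; exact: conn_at0.
have -> : nabla D (fun=> 0) (nabla D (gamma W) (@eta R n M)) u = 0.
  by apply: conn_at0; apply: smooth_conn => //; exact: smooth_gamma.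
by rewrite oppr0 add0r addr0; exact: conn0.
Qed.

(** The term in [Phat] vanishes because [rho (gamma X) = 0]. *)
Lemma berwald_gamma (X W : pvf M) u : smooth_pvf X -> smooth_pvf W ->
  berwald D (gamma X) W u =
  nabla D (gamma X) W u - C u (D u (gamma_at (X u)) eta) (W u).
Proof.
move=> sX sW; rewrite /berwald rho_gamma (Phat0 u sW) addr0.
have sK : smooth_pvf (nabla D (gamma X) (@eta R n M)).
  by apply: smooth_conn; [exact: smooth_gamma|exact: smooth_eta].
by rewrite -(torsionT_tensor hL hD u sK sW).
Qed.

Lemma free_berwald (X : pvf M) (Y Z : pvf M) u (a : R) : tensor_free ->
  smooth_pvf X -> smooth_pvf Y -> smooth_pvf Z ->
  nabla12 (berwald D) (gamma X) T Y Z u = a *: T Y Z u.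
Proof.
move=> C0 sX sY sZ.
have B W : smooth_pvf W -> berwald D (gamma X) W = nabla D (gamma X) W.
  by move=> sW; apply/funext => x; rewrite berwald_gamma // C0 subr0.
have sG := smooth_gamma sX.
rewrite -(free_recurrent u a C0 sG sY sZ) /nabla12 (B Y sY) (B Z sZ).
by rewrite (torsionT_free C0 sY sZ) (B _ smooth_pvf0).
Qed.

Variable zeta : pvf M.
Hypothesis hzeta : concurrent D zeta.
Let sz : smooth_pvf zeta := hzeta.1.

Lemma tensor_zetal u w : C u (zeta u) w = 0.
Proof. by rewrite (cartan_tensor_sym hL hD) (tensor_zeta hL hD hzeta). Qed.

(** Differentiating [T(Y, zeta) = 0] along [beta X] gives
    [(nabla_{beta X} T)(Y, zeta) = T(Y, X)], because the derivative of [zeta] is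
    [- X]; recurrence makes the left-hand side a multiple of [T(Y, zeta) = 0]. *)
Lemma Ch_free l : Ch_recurrent D l -> tensor_free.
Proof.
move=> H u v w; set p := proj u.
have sX := smooth_lift p v; have sY := smooth_lift p w.
have sb : smooth_vf (beta D (lift p v)) by exact: (smooth_beta hlin hreg).
have := H _ _ _ sX sY sz u; rewrite /nabla12.
have sN : smooth_pvf (nabla D (beta D (lift p v)) (lift p w)) by exact: smooth_conn.
have sN' : smooth_pvf (nabla D (beta D (lift p v)) zeta) by exact: smooth_conn.
rewrite (torsionT_zeta hL hD hzeta sY) (torsionT_zeta hL hD hzeta sN).
rewrite (torsionT_tensor hL hD u sY sN').
have [-> _] := hzeta.2 _ sX u.
rewrite !(lift_val _ (erefl p)) (cartan_tensorNr hL hD) opprK scaler0.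
have -> : nabla D (beta D (lift p v)) (fun=> 0) u = 0 by exact: conn0.
by rewrite subr0 add0r (cartan_tensor_sym hL hD).
Qed.

(** [zeta] is constant on the fibre near [u], so its value at [u] can replace its
    value at [y] in [C(zeta, w) = 0]. *)
Lemma third_zeta_near u w z : \forall y \near (val u).2,
  third L (proj u) (zeta u) w z y = 0.
Proof.
have y0 := slit_neq0 u.
apply: filterS2 (near_neq0 y0) (zeta_near hL hD hzeta (proj u) y0) => y nz.
have [u' E] := slit_at (proj u) nz.
rewrite fibre_val (fibre_slit _ E) => <-.
have Ep : proj u' = proj u by rewrite /proj E.
have H := cartan_tensorE hL hD u' (zeta u') w z.
move: H; rewrite tensor_zetal (fmetric0 hL) Ep E /= => /esym /eqP.
by rewrite mulf_eq0 invr_eq0 pnatr_eq0 /= => /eqP.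
Qed.

Lemma smooth_torsionT_lift p v w : smooth_pvf (T (lift p v) (lift p w)).
Proof.
have sv := smooth_lift p v; have sw := smooth_lift p w.
rewrite (torsionT_basic hlin hreg sv sw (basic_lift _ _)).
by apply: smooth_conn => //; exact: smooth_gamma.
Qed.

(** Lowered with [g], the torsion is a third fibre derivative of [L^2], and its
    derivative along [zeta] is a fourth one.  Exchanging [zeta] with [v] makes
    [C(zeta, w)] appear, which is 0. *)
Lemma conn_zeta_torsion u v w :
  nabla D (gamma zeta) (T (lift (proj u) v) (lift (proj u) w)) u = 0.
Proof.
set p := proj u; apply: (@fmetric_nondeg _ _ _ _ hL u) => z.
have sv := smooth_lift p v; have sw := smooth_lift p w; have szz := smooth_lift p z.
have sS := smooth_torsionT_lift p v w.
have H := cartan_metric hD (smooth_gamma sz) sS szz u.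
move: H; rewrite (conn_vertical_lift D zeta _ (erefl p)) tensor_zetal.
rewrite (fmetric0r hL) addr0 (lift_val _ (erefl p)) => <-.
rewrite tderive_vertical.
have y0 := slit_neq0 u.
have E : 'D_(zeta u) (fibre (fun x =>
     fmetric L x (T (lift p v) (lift p w) x) (lift p z x)) (proj u) : 'rV[R]_n -> R^o) (val u).2 =
   'D_(zeta u) (fun y => 4^-1 *: (third L p v w z y : R^o)) (val u).2.
  apply: near_eq_derive; apply: filterS (near_neq0 y0) => y /(slit_at p) [u' E].
  have Ep : proj u' = p by rewrite /proj E.
  rewrite (fibre_slit _ E) (torsionT_tensor hL hD u' sv sw) !(lift_val _ Ep).
  by rewrite (cartan_tensorE hL hD) Ep E.
apply: etrans E _.
have d := Ck_differentiable (smooth_third hL p v w z 1) y0.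
have E := @deriveZ R _ R^o (third L p v w z) 4^-1 (val u).2 (zeta u) (diff_derivable d).
apply: etrans E _.
rewrite (fourth_swap hL p (zeta u) v w z y0).
have E2 : 'D_v (third L p (zeta u) w z : 'rV[R]_n -> R^o) (val u).2 = 0.
  rewrite -[RHS](derive_cst (0 : R^o) (val u).2 v); apply: near_eq_derive.
  exact: third_zeta_near.
by rewrite E2 scaler0.
Qed.

(** The covariant derivative of T along [gamma zeta] is 0: its leading term vanishes
    by [conn_zeta_torsion] and the two others contain [C(zeta, .)]. *)
Lemma zeta_recurrent_free l : (forall u, l u (zeta u) != 0) ->
  (forall p v w u, nabla12 (nabla D) (gamma zeta) T (lift p v) (lift p w) u =
     l u (zeta u) *: T (lift p v) (lift p w) u) ->
  tensor_free.
Proof.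
move=> lz H u v w; set p := proj u.
have sv := smooth_lift p v; have sw := smooth_lift p w.
have sG := smooth_gamma sz.
have := H p v w u; rewrite /nabla12 conn_zeta_torsion.
rewrite (torsionT_tensor hL hD u (smooth_conn sG sv) sw).
rewrite (torsionT_tensor hL hD u sv (smooth_conn sG sw)).
rewrite !(conn_vertical_lift D zeta _ (erefl p)) !tensor_zetal.
rewrite (cartan_tensor0l hD) (cartan_tensor0r hL hD) !subr0.
rewrite (torsionT_tensor hL hD u sv sw) !(lift_val _ (erefl p)) => /esym /eqP.
by rewrite scaler_eq0 (negbTE (lz u)) => /eqP.
Qed.

Lemma Cv_free l : (forall u, l u (zeta u) != 0) -> Cv_recurrent D l -> tensor_free.
Proof.
move=> lz H; apply: (zeta_recurrent_free lz) => p v w u.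
exact: H sz (smooth_lift p v) (smooth_lift p w) u.
Qed.

(** The fibre derivative of [eta] is the identity, and [C(zeta, eta) = 0]. *)
Lemma conn_zeta_eta u : D u (gamma_at (zeta u)) (@eta R n M) = zeta u.
Proof.
have := conn_vertical hL hD u sz (@smooth_eta R n M).
rewrite tensor_zetal addr0 => H; apply: etrans H _.
rewrite -[RHS](derive_id (val u).2); apply: near_eq_derive.
by apply: filterS (near_neq0 (slit_neq0 u)) => y /fibre_eta.
Qed.

(** Along [gamma zeta] the Berwald and the Cartan connections coincide, because
    [K (gamma zeta) = zeta] and [T(zeta, .) = 0]. *)
Lemma C0_free l : (forall u, l u (zeta u) != 0) -> C0_recurrent D l -> tensor_free.
Proof.
move=> lz H; apply: (zeta_recurrent_free lz) => p v w u.
have B W : smooth_pvf W -> berwald D (gamma zeta) W = nabla D (gamma zeta) W.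
  move=> sW; apply/funext => x.
  by rewrite berwald_gamma // conn_zeta_eta tensor_zetal subr0.
have sv := smooth_lift p v; have sw := smooth_lift p w.
rewrite -(H _ _ _ sz sv sw u) /nabla12 (B _ sv) (B _ sw).
by rewrite (B _ (smooth_torsionT_lift p v w)).
Qed.

End Recurrent.

(** * Vanishing of the Cartan tensor and Riemannian metrics *)

Section Riemannian.
Context {R : realType} {n : nat} {M : manifold R n}.
Variable L : tangent M -> R.
Hypothesis hL : finsler L.
Variable D : covder M.
Hypothesis hD : cartan_connection L D.
Implicit Types (u : slit M) (v w z y e : 'rV[R]_n) (p : M).

Lemma free_third p v w z y : tensor_free D -> y != 0 -> third L p v w z y = 0.
Proof.
move=> C0 /(slit_at p) [u E]; have Ep : proj u = p by rewrite /proj E.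
have := cartan_tensorE hL hD u v w z.
rewrite C0 (fmetric0 hL) Ep E => /esym /eqP.
by rewrite mulf_eq0 invr_eq0 pnatr_eq0 /= => /eqP.
Qed.

(** The fibre derivatives of [g] are the components of T, and the vectors compared
    by [riemannian] are joined by two segments that avoid 0. *)
Lemma free_riemannian : tensor_free D -> riemannian L.
Proof.
move=> C0 u u' Ep guard v w.
have seg a b : avoids0 a b ->
    'D_v ('D_w (energy L (proj u))) b = 'D_v ('D_w (energy L (proj u))) a.
  move=> ab; apply: (@segment_constant R _ ('D_v ('D_w (energy L (proj u))))) => t /ab nz; split.
    exact: Ck_differentiable (smooth_energy2 hL (proj u) v w 1) nz.
  exact: (free_third (proj u) (b - a) v w C0 nz).
have [c yc cy] := path_avoids0 (slit_neq0 u) (slit_neq0 u') guard.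
have E1 := seg _ _ yc; have E2 := seg _ _ cy.
rewrite !fmetricE -Ep -E1 E2.
reflexivity.
Qed.

Lemma riemannian_free : riemannian L -> tensor_free D.
Proof.
move=> H u v w; apply: (@fmetric_nondeg _ _ _ _ hL u) => z.
rewrite (cartan_tensorE hL hD).
set p := proj u; have y0 := slit_neq0 u.
have -> : third L p v w z (val u).2 = 0.
  rewrite -[RHS](derive_cst ('D_w ('D_z (energy L p)) (val u).2) (val u).2 v).
  apply: near_eq_derive; apply: filterS2 (near_neq0 y0) (near_half_line y0).
  move=> y /(slit_at p) [u' E] guard.
  have Ep : proj u' = p by rewrite /proj E.
  have guard' : n = 1%N -> exists2 t : R, 0 < t & (val u').2 = t *: (val u).2.
    by rewrite E.
  have := H u u' (esym Ep) guard' w z.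
  rewrite !fmetricE Ep E => /esym.
  by apply: mulfI; rewrite invr_neq0 // pnatr_eq0.
exact: mulr0.
Qed.

End Riemannian.

Theorem theorem3p6 (R : realType) (n : nat) (M : manifold R n)
    (L : tangent M -> R) (hL : finsler L)
    (D : covder M) (hD : cartan_connection L D)
    (zeta : pvf M) (hzeta : concurrent D zeta)
    (lambda_o : slit M -> 'rV[R]_n -> R) (hlambda : pi_form lambda_o)
    (hlz : forall u : slit M, lambda_o u (zeta u) != 0) :
  [<-> Ch_recurrent D lambda_o;
       Cv_recurrent D lambda_o;
       C0_recurrent D lambda_o;
       riemannian L].
Proof.
have free_Ch : tensor_free D -> Ch_recurrent D lambda_o.
  move=> C0 X Y Z sX sY sZ u.
  have sb := smooth_beta (cartan_linear hD) (cartan_regular hD) sX.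
  exact: (free_recurrent hL hD u _ C0 sb sY sZ).
have free_Cv : tensor_free D -> Cv_recurrent D lambda_o.
  move=> C0 X Y Z sX sY sZ u.
  exact: (free_recurrent hL hD u _ C0 (smooth_gamma sX) sY sZ).
have free_C0 : tensor_free D -> C0_recurrent D lambda_o.
  move=> C0 X Y Z sX sY sZ u.
  exact: (free_berwald hL hD u _ C0 sX sY sZ).
tfae.
- by move=> /(Ch_free hL hD hzeta) /free_Cv.
- by move=> /(Cv_free hL hD hzeta hlz) /free_C0.
- by move=> /(C0_free hL hD hzeta hlz) /(free_riemannian hL hD).
- by move=> /(riemannian_free hL hD) /free_Ch.
Qed.
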